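(* Assume model $\mathcal M_{\mathrm s}$ and let $\alpha\in(0,1]$. Then the proposed procedure $\mathbb T^*$ is uniformly optimal in $\mathcal T_\alpha$: $\mathbb T^*\in\mathcal T_\alpha$ and for every $t=1,2,\dots$, $$\mathbb E\big(\mathrm U_t(\mathbb T^* )\big)=\sup_{\mathbb T\in\mathcal T_\alpha}\mathbb E\big(\mathrm U_t(\mathbb T)\big).$$
   Context: There are $K\ge1$ data streams. Each stream $k$ has a change point $\tau_k\in\{0,1,2,\dots\}\cup\{\infty\}$. Observations $X_{k,t}$ ($1\le k\le K$, $t=1,2,\dots$) are, conditionally on $(\tau_1,\dots,\tau_K)$, independent over $k$ and $t$, with $X_{k,t}$ having density $p_{k,t}$ if $t\le\tau_k$ and $q_{k,t}$ if $t>\tau_k$ with respect to a baseline measure $\mu$. Model $\mathcal M_{\mathrm s}$: $\tau_1,\dots,\tau_K$ are i.i.d. with $\mathbb P(\tau_k=m)=\theta(1-\theta)^m$, $m=0,1,2,\dots$, for some $\theta\in(0,1)$, and $p_{k,t}=p$, $q_{k,t}=q$ for all $k,t$. A compound sequential detection procedure consists of index sets $S_1=\{1,\dots,K\}\supseteq S_2\supseteq\cdots$ and a filtration defined inductively by $\mathcal F_1=\sigma(X_{k,1}:1\le k\le K)$ and $\mathcal F_t=\sigma(\mathcal F_{t-1},S_t,X_{k,t}:k\in S_t)$ for $t>1$, where $S_t$ is required to be $\mathcal F_{t-1}$-measurable; equivalently $\mathbb T=(T_1,\dots,T_K)$ with $T_k=\sup\{t:k\in S_t\}$. $\mathcal T$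 is the set of all such procedures. For $t\ge1$, $\mathrm{FNP}_{t+1}(\mathbb T)=\sum_{k\in S_{t+1}}\mathbf 1(\tau_k<t)/(|S_{t+1}|\vee1)$, $\mathrm{LFNR}_{t+1}(\mathbb T)=\mathbb E(\mathrm{FNP}_{t+1}(\mathbb T)\mid\mathcal F_t)$, $\mathrm{LFNR}_1(\mathbb T)=0$. $\mathcal T_\alpha=\{\mathbb T\in\mathcal T:\mathrm{LFNR}_t(\mathbb T)\le\alpha\text{ a.s. for all }t\ge1\}$. Stream utilization: $\mathrm U_t(\mathbb T)=\sum_{s=1}^t|S_s|$. Posterior probabilities: $W_{k,t}=\mathbb P(\tau_k<t\mid\mathcal F_t)$. One-step update rule: given $\alpha$, $S_t$ and $(W_{k,t})_{k\in S_t}$, write $S_t=\{k_1,\dots,k_m\}$ ordered so that $W_{k_1,t}\le\cdots\le W_{k_m,t}$, ties broken so that $k_i<k_{i+1}$ when $W_{k_i,t}=W_{k_{i+1},t}$; set $R_0=0$ and $R_n=\frac1n\sum_{i=1}^nW_{k_i,t}$; let $n$ be the largest element of $\{0,\dots,m\}$ with $R_n\le\alpha$; output $S_{t+1}=\{k_1,\dots,k_n\}$ ($\emptyset$ if $n=0$). The proposed procedure $\mathbb T^*$: $S_1=\{1,\dots,K\}$ and, for every $t\ge1$, $S_{t+1}$ is the output of the one-step update rule applied to $\alpha$, $S_t$ and $(W_{k,t})_{k\in S_t}$. *)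

(* Defs.v *)
From mathcomp Require Import all_boot all_order all_algebra.
From mathcomp Require Import all_classical all_reals all_analysis.
Set Implicit Arguments.
Unset Strict Implicit.
Unset Printing Implicit Defensive.
Import Order.TTheory GRing.Theory Num.Theory.
Local Open Scope classical_set_scope.
Local Open Scope ring_scope.

Section Defs.
Context (R : realType).

(* ---------- change points in {0,1,2,...} U {oo}: None encodes oo ---------- *)
Definition cp_lt (tau : option nat) (t : nat) : bool :=
  if tau is Some m then (m < t)%N else false.

Definition geom_pmf (theta : R) (tau : option nat) : R :=
  if tau is Some m then theta * (1 - theta) ^+ m else 0.

Definition obs_dens (T : Type) (p q : T -> R) (tau : option nat) (s : nat) : T -> R :=
  if cp_lt tau s then q else p.

Definition model_Ms (d dO : measure_display) (Omega : measurableType d)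
  (Obs : measurableType dO) (P : probability Omega R)
  (mu : {measure set Obs -> \bar R}) (K : nat) (theta : R) (p q : Obs -> R)
  (tau : 'I_K -> Omega -> option nat) (X : 'I_K -> nat -> Omega -> Obs) : Prop :=
  [/\ 0 < theta < 1,
      [/\ measurable_fun setT p, forall x, 0 <= p x &
          (\int[mu]_x (p x)%:E = 1)%E],
      [/\ measurable_fun setT q, forall x, 0 <= q x &
          (\int[mu]_x (q x)%:E = 1)%E],
      (forall k m, measurable [set w | tau k w = m]) /\
      (forall k t, measurable_fun setT (X k t)) &
      (* joint law of (tau, X_{.,1..n}) on cylinder sets: tau_1..tau_K iid geometric,
         and conditionally on tau the X_{k,s} are independent with density
         p (s <= tau_k) or q (s > tau_k) *)
      (forall (n : nat) (m : 'I_K -> option nat) (B : 'I_K -> nat -> set Obs),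
         (forall k s, measurable (B k s)) ->
         P [set w | (forall k, tau k w = m k) /\
                    (forall k s, (0 < s <= n)%N -> B k s (X k s w))]
         = ((\prod_(k < K) (geom_pmf theta (m k))%:E) *
            \prod_(k < K) \prod_(1 <= s < n.+1)
               \int[mu]_(x in B k s) (obs_dens p q (m k) s x)%:E)%E)].

(* A procedure is given by its index sets S t (t >= 1), as random sets.
   F_t = sigma(S_s, X_{k,s} : k in S_s, s <= t), i.e. generated by the events
   {k in S_s} and {k in S_s, X_{k,s} in B}. *)
Definition gen_sets (d dO : measure_display) (Omega : measurableType d)
  (Obs : measurableType dO) (K : nat) (X : 'I_K -> nat -> Omega -> Obs)
  (S : nat -> Omega -> {set 'I_K}) (t : nat) : set (set Omega) :=
  [set A | exists k : 'I_K, exists s : nat, (0 < s <= t)%N /\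
     (A = [set w | k \in S s w] \/
      exists B : set Obs, measurable B /\
        A = [set w | k \in S s w /\ B (X k s w)])].

Definition filt (d dO : measure_display) (Omega : measurableType d)
  (Obs : measurableType dO) (K : nat) (X : 'I_K -> nat -> Omega -> Obs)
  (S : nat -> Omega -> {set 'I_K}) (t : nat) : set (set Omega) :=
  <<s gen_sets X S t >>.

Definition is_procedure (d dO : measure_display) (Omega : measurableType d)
  (Obs : measurableType dO) (K : nat) (X : 'I_K -> nat -> Omega -> Obs)
  (S : nat -> Omega -> {set 'I_K}) : Prop :=
  [/\ forall w, S 1%N w = [set: 'I_K]%SET,
      forall t w, (1 <= t)%N -> S t.+1 w \subset S t w &
      forall t (A : {set 'I_K}), (1 <= t)%N ->
        filt X S t [set w | S t.+1 w = A]].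

Definition sub_meas (d : measure_display) (Omega : measurableType d)
  (F : set (set Omega)) (g : Omega -> R) : Prop :=
  forall B : set R, measurable B -> F (g @^-1` B).

Definition cond_exp_version (d : measure_display) (Omega : measurableType d)
  (P : probability Omega R) (F : set (set Omega)) (Z g : Omega -> R) : Prop :=
  [/\ sub_meas F g,
      P.-integrable setT (fun w => (g w)%:E) &
      forall A, F A -> (\int[P]_(w in A) (g w)%:E = \int[P]_(w in A) (Z w)%:E)%E].

Definition FNP (Omega : Type) (K : nat) (tau : 'I_K -> Omega -> option nat)
  (S : nat -> Omega -> {set 'I_K}) (t : nat) (w : Omega) : R :=
  (\sum_(k in S t.+1 w) (cp_lt (tau k w) t)%:R) / (maxn #|S t.+1 w| 1)%:R.

(* membership in T_alpha: LFNR_{t+1} = E(FNP_{t+1} | F_t) <= alpha a.s. for all t >= 1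
   (LFNR_1 = 0 <= alpha holds trivially) *)
Definition in_T_alpha (d dO : measure_display) (Omega : measurableType d)
  (Obs : measurableType dO) (P : probability Omega R) (K : nat)
  (tau : 'I_K -> Omega -> option nat) (X : 'I_K -> nat -> Omega -> Obs)
  (alpha : R) (S : nat -> Omega -> {set 'I_K}) : Prop :=
  is_procedure X S /\
  forall t, (1 <= t)%N -> exists g : Omega -> R,
    cond_exp_version P (filt X S t) (FNP tau S t) g /\
    {ae P, forall w, g w <= alpha}.

Definition util (Omega : Type) (K : nat) (S : nat -> Omega -> {set 'I_K})
  (t : nat) (w : Omega) : R :=
  (\sum_(1 <= s < t.+1) #|S s w|)%:R.

Definition update_rule (K : nat) (alpha : R) (St : {set 'I_K}) (W : 'I_K -> R)
  : {set 'I_K} :=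
  let l := sort (fun i j : 'I_K => (W i < W j) || ((W i == W j) && (i <= j)%N))
                (enum St) in
  let Rn := fun n : nat =>
              if n is 0%N then 0 else (\sum_(i <- take n l) W i) / n%:R in
  let n := (\max_(n < (size l).+1 | (Rn n <= alpha)%R) (n : nat))%N in
  [set k in take n l].

(* S is (a realization of) the proposed procedure T^*: S_1 = all streams and
   S_{t+1} is the update rule applied to S_t and the posterior probabilities
   W_{k,t} = P(tau_k < t | F_t) (for some version of these). *)
Definition is_Tstar (d dO : measure_display) (Omega : measurableType d)
  (Obs : measurableType dO) (P : probability Omega R) (K : nat)
  (tau : 'I_K -> Omega -> option nat) (X : 'I_K -> nat -> Omega -> Obs)
  (alpha : R) (S : nat -> Omega -> {set 'I_K}) : Prop :=
  is_procedure X S /\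
  forall t, (1 <= t)%N -> exists W : 'I_K -> Omega -> R,
    (forall k, cond_exp_version P (filt X S t)
                 (fun w => (cp_lt (tau k w) t)%:R) (W k)) /\
    forall w, S t.+1 w = update_rule alpha (S t w) (fun k => W k w).

End Defs.

(* Main.v *)
Require Import Defs.
From HB Require Import structures.
From mathcomp Require Import all_boot all_order all_algebra.
From mathcomp Require Import perm.
From mathcomp Require Import all_classical all_reals all_analysis.
From mathcomp Require Import measurable_realfun ring lra.
Set Implicit Arguments.
Unset Strict Implicit.
Unset Printing Implicit Defensive.
Import Order.TTheory GRing.Theory Num.Theory.
Import numFieldNormedType.Exports.
Import HBNNSimple.
Local Open Scope classical_set_scope.
Local Open Scope ring_scope.

(* Each stream carries the posterior probability [w] that it has changed.  It evolves
   as a Markov chain: [w] becomes the prior [c = th + (1 - th) w], the next observation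
   has density [c q + (1 - c) p], and Bayes' rule gives the new [w].  Conditionally on
   the past the streams evolve independently, even when all streams are observed
   forever, so the filtration of any procedure may be enlarged to the full history.
   For the Markov decision problem "keep a subset of average weight at most alpha", let
   [value n A w] be the largest expected number of streams kept after [n] steps.  It is
   monotone in [A], antitone in the weights of [A] (the kernel is stochastically
   monotone, by a monotone likelihood ratio argument) and symmetric; hence exchanging a
   stream for one of smaller weight can only help, and keeping as many of the smallest
   weights as possible is optimal simultaneously for every horizon [n].  So
   [E (value n (S_s) (w_s))] with [n + s] fixed is nonincreasing in [s] for every
   admissible procedure and constant for the greedy one; at [s = 1] it does not depend
   on the procedure, and at [n = 0] it is the expected number of active streams. *)

(** The obstacle to comparing a stream of larger weight with one of smaller weight is that the
    weight governs both the law of the next observation and the update; the two effects have to be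
    bounded together, under the integral. The transition of all streams is a composition of
    one-coordinate kernels. These commute by Fubini, which gives the symmetry behind the exchange.
    Histories are accordingly allowed to contain a different number of observations of each stream,
    so that posterior formulas are proved by adding one observation at a time. Two filtrations must
    be reconciled: the weights are posteriors given everything, whereas LFNR and the update rule
    refer to the procedure's own filtration, for which the weight of a dropped stream need not be
    measurable. Only the weights of active streams matter, and these agree for both filtrations, up
    to null sets because versions of conditional expectations are arbitrary. Finally, Fubini asks
    for a sigma-finite base measure, and the existence of the procedure asks for posteriors given a
    filtration that is itself being built. *)

(** Proved by simple functions rather than through Radon-Nikodym derivatives, because it is applied
    to a base measure that may fail to be sigma-finite. *)
Lemma ge0_integral_density d (T : measurableType d) (R : realType)
  (mu rho : {measure set T -> \bar R}) (g : T -> R) (f : T -> \bar R) :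
  measurable_fun setT g -> (forall x, 0 <= g x) ->
  (forall A, measurable A -> rho A = \int[mu]_(x in A) (g x)%:E)%E ->
  measurable_fun setT f -> (forall x, 0 <= f x)%E ->
  (\int[rho]_x f x = \int[mu]_x (f x * (g x)%:E))%E.
Proof.
move=> mg g0 rhoE mf f0.
have mgE : measurable_fun setT (EFin \o g) by exact/measurable_EFinP.
pose h := nnsfun_approx measurableT mf.
have hf x : (EFin \o h n) x @[n --> \oo] --> f x by exact: cvg_nnsfun_approx.
have hnd x a b : (a <= b)%N -> (h a x <= h b x)%R.
  by move=> ab; exact/lefP/nd_nnsfun_approx.
have -> : (\int[rho]_x f x = lim (\int[rho]_x (EFin \o h n) x @[n --> \oo]))%E.
  under eq_integral => x _ do rewrite -(cvg_lim _ (hf x))//.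
  apply: monotone_convergence => //.
  - by move=> n; exact/measurable_EFinP.
  - by move=> n x _ /=; rewrite lee_fin.
  - by move=> x _ a b ab; rewrite lee_fin hnd.
have -> : (\int[mu]_x (f x * (g x)%:E) =
    lim (\int[mu]_x ((EFin \o h n) x * (g x)%:E) @[n --> \oo]))%E.
  have fg x : (f x * (g x)%:E = lim (((EFin \o h n) x * (g x)%:E) @[n --> \oo]))%E.
    by apply/esym/cvg_lim => //; apply: cvgeZr.
  under eq_integral => x _ do rewrite fg.
  apply: monotone_convergence => //.
  - move=> n; apply: emeasurable_funM => //.
    exact/measurable_EFinP.
  - by move=> n x _ /=; rewrite mule_ge0 ?lee_fin.
  - by move=> x _ a b ab/=; rewrite lee_wpmul2r ?lee_fin ?hnd.
(* Both sides are limits along the same increasing simple functions; on a level set of one of them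
   the identity is [rhoE]. *)
suff suf n : (\int[mu]_x ((EFin \o h n) x * (g x)%:E) = \int[rho]_x (EFin \o h n) x)%E.
  by apply: congr_lim; apply/funext => n; rewrite suf.
transitivity (\int[rho]_x
   (\sum_(y \in range (h n)) (y * \1_(h n @^-1` [set y]) x)%:E))%E; last first.
  by apply: eq_integral => t tE; rewrite /= fimfunE -fsumEFin.
have indich m r : measurable_fun setT (fun x => (r * \1_(h m @^-1` [set r]) x)%:E).
  by apply: (measurable_comp measurableT) => //; exact: measurable_funM.
rewrite ge0_integral_fsum//; last by move=> m y Ey; exact: nnfun_muleindic_ge0.
transitivity (\int[mu]_x (\sum_(y \in range (h n))
    (y * \1_(h n @^-1` [set y]) x)%:E * (g x)%:E))%E.
  apply: eq_integral => x _.
  rewrite -ge0_mule_fsuml => [|y]; last exact: nnfun_muleindic_ge0.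
  by rewrite fsumEFin//= -(fimfunE _ x).
rewrite ge0_integral_fsum//; last 2 first.
  - by move=> y; apply: emeasurable_funM.
  - by move=> m y Ey; rewrite mule_ge0 ?lee_fin// -lee_fin EFinM nnfun_muleindic_ge0.
apply: eq_fsbigr => r rhn.
have r0 : 0 <= r by move: rhn; rewrite inE => -[t _ <-].
have mr : measurable (h n @^-1` [set r]) by [].
under eq_integral do rewrite EFinM -muleA.
under [RHS]eq_integral do rewrite EFinM.
have m1 : measurable_fun setT (fun x => (\1_(h n @^-1` [set r]) x)%:E : \bar R)%E.
  exact/measurable_EFinP.
rewrite [LHS]ge0_integralZl//; last 2 first.
- exact: emeasurable_funM.
- by move=> x _; rewrite mule_ge0 ?lee_fin.
rewrite [RHS]ge0_integralZl// integral_indic// setIT rhoE//; congr (_ * _)%E.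
under eq_integral do rewrite muleC.
by rewrite [RHS]integral_mkcond/=; apply: eq_integral => x _; rewrite epatch_indic.
Qed.

(** * Bayes update of one stream *)

Section BayesUpdate.
Context (R : realType).

(** The dynamic program lets weights range over all reals. Truncation makes [prior] a probability
    for each of them and does not affect genuine posteriors. *)
Definition clip (w : R) : R := Num.max 0 (Num.min 1 w).

(** The geometric law has constant hazard [th]: a stream not yet changed, of probability [1 - w],
    changes next with probability [th]. *)
Definition prior (th w : R) : R := th + (1 - th) * clip w.

Definition mix (c u v : R) : R := c * u + (1 - c) * v.

Definition bayes (c u v : R) : R := c * u / mix c u v.

Lemma clip_ge0 w : 0 <= clip w.
Proof. by rewrite le_max lexx. Qed.

Lemma clip_le1 w : clip w <= 1.
Proof. by rewrite ge_max ler01 ge_min lexx. Qed.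

Lemma clip_id w : 0 <= w <= 1 -> clip w = w.
Proof. by move=> /andP[w0 w1]; rewrite /clip (min_idPr w1) (max_idPr w0). Qed.

Lemma clip_homo w w' : w <= w' -> clip w <= clip w'.
Proof.
by move=> ww'; rewrite /clip ge_max le_max lexx/= le_max le_min !ge_min lexx ww' !orbT.
Qed.

Lemma mix_ge0 c u v : 0 <= c <= 1 -> 0 <= u -> 0 <= v -> 0 <= mix c u v.
Proof. by move=> /andP[c0 c1] u0 v0; rewrite addr_ge0 ?mulr_ge0 ?subr_ge0. Qed.

(** If the mixture vanishes, so does its nonnegative summand [c * u]; the product form of Bayes'
    rule thus survives division by zero, which yields 0. *)
Lemma bayesM c u v : 0 <= c <= 1 -> 0 <= u -> 0 <= v ->
  bayes c u v * mix c u v = c * u.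
Proof.
move=> c01 u0 v0; have [m0|m0] := eqVneq (mix c u v) 0; last by rewrite /bayes divfK.
rewrite m0 mulr0; move: m0 c01; rewrite /mix => /eqP + /andP[c0 c1].
by rewrite paddr_eq0 ?mulr_ge0 ?subr_ge0// => /andP[/eqP ->].
Qed.

Lemma bayesMC c u v : 0 <= c <= 1 -> 0 <= u -> 0 <= v ->
  (1 - bayes c u v) * mix c u v = (1 - c) * v.
Proof. by move=> *; rewrite mulrBl bayesM// mul1r /mix addrAC subrr add0r. Qed.

Lemma bayes_itv c u v : 0 <= c <= 1 -> 0 <= u -> 0 <= v -> 0 <= bayes c u v <= 1.
Proof.
move=> /[dup] c01 /andP[c0 c1] u0 v0; rewrite /bayes divr_ge0 ?mulr_ge0 ?mix_ge0//=.
have [->|m0] := eqVneq (mix c u v) 0; first by rewrite invr0 mulr0.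
rewrite ler_pdivrMr ?mul1r; last by rewrite lt_neqAle eq_sym m0 mix_ge0.
by rewrite /mix lerDl mulr_ge0 ?subr_ge0.
Qed.

Variable th : R.
Hypothesis th01 : 0 < th < 1.

Lemma prior_homo w w' : w <= w' -> prior th w <= prior th w'.
Proof.
by move=> ww'; rewrite lerD2l ler_wpM2l ?subr_ge0 ?clip_homo// ltW//; case/andP: th01.
Qed.

Lemma prior_itv w : 0 < prior th w <= 1.
Proof.
case/andP: th01 => t0 t1; have c0 := clip_ge0 w; have c1 := clip_le1 w.
by rewrite /prior; apply/andP; split; nra.
Qed.

Lemma prior01 w : 0 <= prior th w <= 1.
Proof. by have /andP[/ltW -> ->] := prior_itv w. Qed.

(* Monotone likelihood ratio in integrand form: integrating both sides against
   the base measure cancels the constant [f c'], because [mix c q p] and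
   [mix c' q p] both have mass one. *)
Lemma bayes_antitone (f : R -> R) c c' u v : {homo f : x y / x <= y >-> y <= x} ->
  0 < c -> c <= c' -> c' <= 1 -> 0 <= u -> 0 <= v ->
  f (bayes c' u v) * mix c' u v + f c' * mix c u v <=
  f (bayes c u v) * mix c u v + f c' * mix c' u v.
Proof.
move=> fh c0 cc c1 u0 v0.
have c01 : 0 <= c <= 1 by apply/andP; split; lra.
have c01' : 0 <= c' <= 1 by apply/andP; split; lra.
have m0 := mix_ge0 c01 u0 v0; have m0' := mix_ge0 c01' u0 v0.
have b1 := bayesM c01 u0 v0; have b2 := bayesM c01' u0 v0.
set m := mix c u v in m0 b1 *; set m' := mix c' u v in m0' b2 *.
set b := bayes c u v in b1 *; set b' := bayes c' u v in b2 *.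
have mm : m' - m = (c' - c) * (u - v) by rewrite /m /m' /mix; ring.
have mE : m = c * u + (1 - c) * v by [].
have mE' : m' = c' * u + (1 - c') * v by [].
have [m'0|m'0] := eqVneq m' 0.
  rewrite m'0 !mulr0 add0r addr0; apply: ler_wpM2r => //.
  have u00 : u = 0.
    have : c' * u = 0 by apply/eqP; rewrite eq_le mulr_ge0 ?andbT//; nra.
    by move=> /eqP; rewrite mulf_eq0 gt_eqF ?(lt_le_trans c0)//= => /eqP.
  by apply: fh; rewrite /b /bayes u00 mulr0 mul0r ltW// (lt_le_trans c0).
have m'p : 0 < m' by rewrite lt_neqAle eq_sym m'0.
have [m00|m00] := eqVneq m 0.
  have u00 : u = 0.
    have : c * u = 0 by apply/eqP; rewrite eq_le mulr_ge0 ?andbT//; nra.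
    by move=> /eqP; rewrite mulf_eq0 gt_eqF//= => /eqP.
  have : c' = 1 \/ v = 0.
    have : (1 - c) * v = 0 by move: mE; rewrite u00 mulr0 add0r m00 => <-.
    move=> /eqP; rewrite mulf_eq0 subr_eq0 => /orP[/eqP|/eqP]; last by right.
    by left; lra.
  by case=> [ce|ve]; move: m'p; rewrite mE' u00 ?ce ?ve; lra.
have mp : 0 < m by rewrite lt_neqAle eq_sym m00.
(* The posterior is monotone in the prior, so on the right-hand side [f b] may be lowered to
   [f b']. *)
have bb : b <= b'.
  rewrite /b /b' /bayes ler_pdivrMr// mulrAC ler_pdivlMr// -/m -/m' mE mE'.
  suff : 0 <= (c' - c) * (u * v) by lra.
  by rewrite !mulr_ge0// subr_ge0.
apply: (@le_trans _ _ (f b' * m + f c' * m')); last first.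
  by rewrite lerD2r ler_wpM2r// fh.
(* What remains is that [(f c' - f b') * (m' - m)] is nonnegative. The sign of [u - v] decides both
   whether the observation moves [c'] up or down to [b'] and whether the mixture grows with the
   prior, so the two factors have the same sign. *)
have [uv|/ltW uv] := leP v u.
  have cb : c' <= b'.
    rewrite /b' /bayes ler_pdivlMr// ler_wpM2l//; first by case/andP: c01'.
    by rewrite -/m' mE'; nra.
  have : 0 <= (f c' - f b') * (m' - m).
    by rewrite mm !mulr_ge0 ?subr_ge0// fh.
  lra.
have cb : b' <= c'.
  rewrite /b' /bayes ler_pdivrMr// ler_wpM2l//; first by case/andP: c01'.
  by rewrite -/m' mE'; nra.
have : 0 <= (f b' - f c') * (m - m').
  by rewrite -(opprB m') mm -mulrN opprB !mulr_ge0 ?subr_ge0// fh.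
lra.
Qed.

End BayesUpdate.

(** * One-step operators *)

Lemma measurable_funVr d (T : measurableType d) (R : realType) (f : T -> R) :
  measurable_fun setT f -> measurable_fun setT (fun x => (f x)^-1).
Proof.
move=> mf; apply: (@measurableT_comp _ _ _ _ _ _ (@GRing.inv R)) => //.
have -> : [set: R] = [set 0] `|` ~` [set 0] by rewrite setUv.
apply/measurable_funU => //; first exact: measurableC.
split; first by apply: measurable_fun_set1.
apply: open_continuous_measurable_fun; first exact/closed_openC/closed_eq.
by move=> x; rewrite inE /= => /eqP x0; exact: inv_continuous.
Qed.

Section Operators.
Context (R : realType) (dO : measure_display) (Obs : measurableType dO)
  (I : finType) (nu : {sigma_finite_measure set Obs -> \bar R}) (th : R)
  (p q : Obs -> R).
Hypothesis th01 : 0 < th < 1.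
Hypotheses (mp : measurable_fun setT p) (mq : measurable_fun setT q).
Hypotheses (p0 : forall x, 0 <= p x) (q0 : forall x, 0 <= q x).
Hypotheses (p1 : (\int[nu]_x (p x)%:E = 1)%E) (q1 : (\int[nu]_x (q x)%:E = 1)%E).

Implicit Types (f g : (I -> R) -> R) (w : I -> R) (A B C : {set I}).

Definition upd w (j : I) (y : R) : I -> R := fun k => if k == j then y else w k.

(* Measurability on [I -> R] without equipping that type with a sigma-algebra. *)
Definition mfunctional f := forall d (H : measurableType d) (u : H -> I -> R),
  (forall k, measurable_fun setT (fun h => u h k)) ->
  measurable_fun setT (fun h => f (u h)).

Definition bounded_mfun (c : R) f := mfunctional f /\ forall w, 0 <= f w <= c.

Definition obs_mix (w : R) (x : Obs) : R := mix (prior th w) (q x) (p x).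

Definition obs_upd (w : R) (x : Obs) : R := bayes (prior th w) (q x) (p x).

(** Transition operator of one coordinate: the expectation of [f] after one more observation of
    stream [j]. For bounded [f] the integral is finite, so [fine] loses nothing. *)
Definition step (j : I) f w : R :=
  fine (\int[nu]_x (f (upd w j (obs_upd (w j) x)) * obs_mix (w j) x)%:E).

Lemma obs_mix_ge0 (w : R) x : 0 <= obs_mix w x.
Proof. exact: mix_ge0 (prior01 th01 w) (q0 x) (p0 x). Qed.

Lemma obs_upd_itv (w : R) x : 0 <= obs_upd w x <= 1.
Proof. exact: bayes_itv (prior01 th01 w) (q0 x) (p0 x). Qed.

Section Measurability.
Context d (H : measurableType d) (w : H -> R) (x : H -> Obs).
Hypotheses (mw : measurable_fun setT w) (mx : measurable_fun setT x).

Lemma measurable_prior : measurable_fun setT (fun h => prior th (w h)).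
Proof.
apply: measurable_funD => //; apply: measurable_funM => //.
by apply: measurable_maxr => //; apply: measurable_minr.
Qed.

Lemma measurable_obs_mix : measurable_fun setT (fun h => obs_mix (w h) (x h)).
Proof.
have mpr := measurable_prior.
apply: measurable_funD; apply: measurable_funM => //.
- by apply: measurableT_comp mx.
- by apply: measurable_funB.
- by apply: measurableT_comp mx.
Qed.

Lemma measurable_obs_upd : measurable_fun setT (fun h => obs_upd (w h) (x h)).
Proof.
apply: measurable_funM; last exact/measurable_funVr/measurable_obs_mix.
by apply: measurable_funM; [exact: measurable_prior | exact: measurableT_comp mx].
Qed.

End Measurability.

Lemma measurable_upd d (H : measurableType d) (u : H -> I -> R) j (y : H -> R) :
  (forall k, measurable_fun setT (fun h => u h k)) -> measurable_fun setT y ->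
  forall k, measurable_fun setT (fun h => upd (u h) j (y h) k).
Proof. by move=> mu my k; rewrite /upd; case: (k == j). Qed.

Lemma measurable_step_integrand f d (H : measurableType d) (u : H -> I -> R)
    (w : H -> R) (x : H -> Obs) (j : I) :
  mfunctional f -> (forall k, measurable_fun setT (fun h => u h k)) ->
  measurable_fun setT w -> measurable_fun setT x ->
  measurable_fun setT
    (fun h => f (upd (u h) j (obs_upd (w h) (x h))) * obs_mix (w h) (x h)).
Proof.
move=> mf mu mw mx; apply: measurable_funM; last exact: measurable_obs_mix.
by apply: mf; apply: measurable_upd => //; exact: measurable_obs_upd.
Qed.

Lemma integral_obs_mix (w : R) : (\int[nu]_x (obs_mix w x)%:E = 1)%E.
Proof.
have /andP[c0 c1] := prior01 th01 w.
rewrite /obs_mix /mix.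
under eq_integral do rewrite EFinD !EFinM.
have mp' : measurable_fun setT (EFin \o p) by exact/measurable_EFinP.
have mq' : measurable_fun setT (EFin \o q) by exact/measurable_EFinP.
rewrite ge0_integralD//=; last 4 first.
- by move=> x _; rewrite mule_ge0// lee_fin.
- exact: measurable_funeM.
- by move=> x _; rewrite mule_ge0// lee_fin// subr_ge0.
- exact: measurable_funeM.
rewrite !ge0_integralZl ?lee_fin ?subr_ge0//.
- by rewrite q1 p1 !mule1 -EFinD addrC subrK.
- by move=> x _; rewrite lee_fin.
- by move=> x _; rewrite lee_fin.
Qed.


Lemma measurable_stepx f w (a : R) (j : I) : mfunctional f ->
  measurable_fun setT (fun x => f (upd w j (obs_upd a x)) * obs_mix a x).
Proof.
move=> mf.
by apply: (@measurable_step_integrand f _ Obs (fun=> w) (fun=> a) id j).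
Qed.

Lemma stepE c j f w : bounded_mfun c f ->
  (step j f w)%:E =
  (\int[nu]_x (f (upd w j (obs_upd (w j) x)) * obs_mix (w j) x)%:E)%E.
Proof.
move=> [mf fc]; rewrite fineK// ge0_fin_numE; last first.
  apply: integral_ge0 => x _; rewrite lee_fin mulr_ge0 ?obs_mix_ge0//.
  by case/andP: (fc (upd w j (obs_upd (w j) x))).
apply: (@le_lt_trans _ _ (\int[nu]_x (c%:E * (obs_mix (w j) x)%:E))%E).
  apply: ge0_le_integral => //.
  - move=> x _; rewrite lee_fin mulr_ge0 ?obs_mix_ge0//.
    by case/andP: (fc (upd w j (obs_upd (w j) x))).
  - exact/measurable_EFinP/measurable_stepx.
  - by apply/measurable_funeM/measurable_EFinP; exact: measurable_obs_mix.
  - move=> x _; rewrite -EFinM lee_fin ler_wpM2r ?obs_mix_ge0//.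
    by case/andP: (fc (upd w j (obs_upd (w j) x))).
rewrite ge0_integralZl//.
- by rewrite integral_obs_mix mule1 ltry.
- by apply/measurable_EFinP; exact: measurable_obs_mix.
- by move=> x _; rewrite lee_fin obs_mix_ge0.
- by case/andP: (fc w) => f0 /(le_trans f0).
Qed.

(** Measurability in the parameter is Tonelli on [H * Obs]; this is why [mfunctional] quantifies
    over every parameter space. The bound [c] is kept because the kernel has mass one. *)
Lemma bounded_step c j f : bounded_mfun c f -> bounded_mfun c (step j f).
Proof.
move=> fP; have [mf fc] := fP; split.
  move=> d H u mu.
  have : measurable_fun setT (fubini_F nu (fun z : H * Obs =>
     (f (upd (u z.1) j (obs_upd (u z.1 j) z.2)) * obs_mix (u z.1 j) z.2)%:E)).
    apply: measurable_fun_fubini_tonelli_F; last first.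
      move=> z; rewrite lee_fin mulr_ge0 ?obs_mix_ge0//.
      by case/andP: (fc (upd (u z.1) j (obs_upd (u z.1 j) z.2))).
    apply/measurable_EFinP.
    apply: (@measurable_step_integrand f _ (H * Obs)%type (fun z => u z.1)) => //.
    - by move=> k; apply: measurableT_comp (mu k) _.
    - by apply: measurableT_comp (mu j) _.
  by move=> /(measurableT_comp (@fine_measurable R _ measurableT)).
move=> w.
rewrite -!lee_fin (stepE _ _ fP); apply/andP; split.
  apply: integral_ge0 => x _; rewrite lee_fin mulr_ge0 ?obs_mix_ge0//.
  by case/andP: (fc (upd w j (obs_upd (w j) x))).
have -> : (c%:E = \int[nu]_x (c * obs_mix (w j) x)%:E)%E.
  under eq_integral do rewrite EFinM.
  rewrite ge0_integralZl//.
  - by rewrite integral_obs_mix mule1.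
  - by apply/measurable_EFinP; exact: measurable_obs_mix.
  - by move=> x _; rewrite lee_fin obs_mix_ge0.
  - by case/andP: (fc w) => f0 /(le_trans f0).
apply: ge0_le_integral => //.
- move=> x _; rewrite lee_fin mulr_ge0 ?obs_mix_ge0//.
  by case/andP: (fc (upd w j (obs_upd (w j) x))).
- exact/measurable_EFinP/measurable_stepx.
- by apply/measurable_EFinP/measurable_funM => //; exact: measurable_obs_mix.
- move=> x _; rewrite lee_fin ler_wpM2r ?obs_mix_ge0//.
  by case/andP: (fc (upd w j (obs_upd (w j) x))).
Qed.

Lemma le_step c j f g w : bounded_mfun c f -> bounded_mfun c g ->
  (forall w, f w <= g w) -> step j f w <= step j g w.
Proof.
move=> fP gP fg; rewrite -lee_fin (stepE _ _ fP) (stepE _ _ gP).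
apply: ge0_le_integral => //.
- move=> x _; rewrite lee_fin mulr_ge0 ?obs_mix_ge0//.
  by case: fP => _ /(_ (upd w j (obs_upd (w j) x)))/andP[].
- by case: fP => mf _; exact/measurable_EFinP/measurable_stepx.
- by case: gP => mf _; exact/measurable_EFinP/measurable_stepx.
- by move=> x _; rewrite lee_fin ler_wpM2r ?obs_mix_ge0.
Qed.

Lemma step_cst c j f w a : bounded_mfun c f ->
  (forall y, f (upd w j y) = a) -> step j f w = a.
Proof.
move=> fP fa; apply: EFin_inj; rewrite (stepE _ _ fP).
under eq_integral do rewrite fa EFinM.
rewrite ge0_integralZl//.
- by rewrite integral_obs_mix mule1.
- by apply/measurable_EFinP; exact: measurable_obs_mix.
- by move=> x _; rewrite lee_fin obs_mix_ge0.
- by rewrite -(fa 0); case: fP => _ /(_ (upd w j 0))/andP[].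
Qed.

(** Nothing relates [v] and [w] outside [A], so this also says that [f] ignores the coordinates
    outside [A]. *)
Definition antitone_on A f :=
  forall v w, (forall i, i \in A -> v i <= w i) -> f w <= f v.

Lemma step_antitone c j A f : bounded_mfun c f -> antitone_on A f ->
  antitone_on A (step j f).
Proof.
move=> fP fA v w vw; have [mf fc] := fP.
have f0 u : 0 <= f u by case/andP: (fc u).
have [jA|jA] := boolP (j \in A); last first.
  have cst u : step j f u = f u.
    apply: (step_cst fP) => y; apply/eqP; rewrite eq_le !fA// => i iA;
    by rewrite /upd; case: eqP => // ij; move: jA; rewrite -ij iA.
  by rewrite !cst fA.
have mI u a : measurable_fun setT (fun x => (f (upd u j (obs_upd a x)) * obs_mix a x)%:E).
  exact/measurable_EFinP/measurable_stepx.
have I0 u a x : (0 <= (f (upd u j (obs_upd a x)) * obs_mix a x)%:E)%E.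
  by rewrite lee_fin mulr_ge0 ?obs_mix_ge0.
have mm a : measurable_fun setT (fun x => (obs_mix a x)%:E).
  by apply/measurable_EFinP; exact: measurable_obs_mix.
have m0 a x : (0 <= (obs_mix a x)%:E)%E by rewrite lee_fin obs_mix_ge0.
pose k := f (upd w j (prior th (w j))).
have k0 : 0 <= k by exact: f0.
have kint a : (\int[nu]_x (k%:E * (obs_mix a x)%:E) = k%:E)%E.
  by rewrite ge0_integralZl// integral_obs_mix mule1.
have km a : measurable_fun setT (fun x => k%:E * (obs_mix a x)%:E)%E.
  exact: measurable_funeM.
have km0 a x : (0 <= k%:E * (obs_mix a x)%:E)%E by rewrite mule_ge0 ?m0// lee_fin.
rewrite -lee_fin !(stepE _ _ fP).
(* The intermediate term draws stream [j] according to [v] and takes the other coordinates from [w].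
   Adding [k] to both sides, as an integral against two different mixtures of mass one, reduces the
   first inequality to a pointwise one. *)
apply: (@le_trans _ _ (\int[nu]_x (f (upd w j (obs_upd (v j) x)) * obs_mix (v j) x)%:E)%E).
  rewrite -(@leeD2rE _ k%:E)// -[X in (_ + X <= _)%E](kint (v j)).
  rewrite -[X in (_ <= _ + X)%E](kint (w j)).
  rewrite -!ge0_integralD//.
  apply: ge0_le_integral => //.
  - by move=> x _; rewrite adde_ge0.
  - by apply: emeasurable_funD.
  - by apply: emeasurable_funD.
  - move=> x _; rewrite -!EFinM -!EFinD lee_fin.
    have /andP[c0 _] := prior_itv th01 (v j).
    have /andP[_ c1] := prior_itv th01 (w j).
    apply: (@bayes_antitone _ (fun y => f (upd w j y))) => //.
      move=> y z yz; apply: fA => i iA; rewrite /upd; case: eqP => //.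
    by apply: prior_homo => //; exact: vw.
apply: ge0_le_integral => // x _; rewrite lee_fin ler_wpM2r ?obs_mix_ge0//.
by apply: fA => i iA; rewrite /upd; case: eqP => // _; exact: vw.
Qed.

Lemma step_relabel j f (s : I -> I) w : involutive s ->
  step j (fun w => f (w \o s)) w = step (s j) f (w \o s).
Proof.
move=> sK; rewrite /step /= sK; congr fine; apply: eq_integral => x _.
congr (f _ * _)%:E; apply/funext => k; rewrite /upd /=.
by rewrite -(inj_eq (can_inj sK) k) sK.
Qed.

Lemma step2E c i j f w : bounded_mfun c f -> i != j ->
  ((step i (step j f) w)%:E =
   \int[nu]_x \int[nu]_y
     (f (upd (upd w i (obs_upd (w i) x)) j (obs_upd (w j) y)) *
      obs_mix (w j) y * obs_mix (w i) x)%:E)%E.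
Proof.
move=> fP ij; have [mf fc] := fP.
have f0 u : 0 <= f u by case/andP: (fc u).
rewrite (stepE _ _ (bounded_step j fP)); apply: eq_integral => x _.
rewrite EFinM (stepE _ _ fP) muleC -ge0_integralZl ?lee_fin ?obs_mix_ge0//.
- apply: eq_integral => y _; rewrite /upd eq_sym (negbTE ij) -EFinM.
  by congr EFin; ring.
- exact/measurable_EFinP/measurable_stepx.
- by move=> y _; rewrite lee_fin mulr_ge0// obs_mix_ge0.
Qed.

(** Distinct streams update distinct coordinates, each from its own weight, so both compositions are
    the same double integral in the two orders. *)
Lemma step_comm c i j f : bounded_mfun c f -> step i (step j f) = step j (step i f).
Proof.
move=> fP; have [->//|ij] := eqVneq i j; have [mf fc] := fP.
have f0 u : 0 <= f u by case/andP: (fc u).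
apply/funext => w; apply: EFin_inj.
rewrite (step2E _ fP ij) (step2E _ fP); last by rewrite eq_sym.
pose F z := (f (upd (upd w i (obs_upd (w i) z.1)) j (obs_upd (w j) z.2)) *
      obs_mix (w j) z.2 * obs_mix (w i) z.1)%:E.
rewrite (@fubini_tonelli _ _ _ _ _ nu nu F).
- apply: eq_integral => y _; apply: eq_integral => x _; rewrite /F /=.
  rewrite -!mulrA (mulrC (obs_mix _ x)); congr (f _ * _)%:E.
  apply/funext => k; rewrite /upd; case: eqP => // ->.
  by rewrite eq_sym (negbTE ij).
- apply/measurable_EFinP; apply: measurable_funM; last exact: measurable_obs_mix.
  apply: (@measurable_step_integrand f _ _ (fun z => upd w i (obs_upd (w i) z.1))) => //.
  by apply: measurable_upd => //; exact: measurable_obs_upd.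
- by move=> z; rewrite lee_fin !mulr_ge0 ?obs_mix_ge0.
Qed.

Definition steps (s : seq I) f := foldr step f s.

Lemma bounded_steps c s f : bounded_mfun c f -> bounded_mfun c (steps s f).
Proof. by move=> fP; elim: s => //= j s; exact: bounded_step. Qed.

Lemma le_steps c s f g : bounded_mfun c f -> bounded_mfun c g ->
  (forall w, f w <= g w) -> forall w, steps s f w <= steps s g w.
Proof.
move=> fP gP fg; elim: s => //= j s IH w.
by apply: (@le_step c) => //; exact: bounded_steps.
Qed.

Lemma steps_antitone c s A f : bounded_mfun c f -> antitone_on A f ->
  antitone_on A (steps s f).
Proof.
move=> fP fA; elim: s => //= j s; apply: step_antitone; exact: bounded_steps fP.
Qed.

Lemma steps_relabel s' f (s : I -> I) w : involutive s ->
  steps s' (fun w => f (w \o s)) w = steps (map s s') f (w \o s).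
Proof.
move=> sK; elim: s' w => //= j s' IH w.
rewrite -step_relabel//; congr step; apply/funext => v; exact: IH.
Qed.

Lemma steps_perm c s t f : bounded_mfun c f -> perm_eq s t -> steps s f = steps t f.
Proof.
move=> fP; elim: s t => [|x s IH] t; first by rewrite perm_sym => /perm_nilP ->.
move=> pst; have : x \in t by rewrite -(perm_mem pst) mem_head.
move: pst => + xt; case/splitPr: xt => t1 t2.
rewrite -(cat1s x t2) perm_sym perm_catCA perm_sym /= perm_cons => /IH /= ->.
elim: t1 {IH} => //= y t1 <-; apply: (@step_comm c); exact: bounded_steps.
Qed.

Definition stepT f := steps (enum I) f.

(** Relabelling only permutes the list of streams to be advanced, and the order is immaterial
    because the steps commute. *)
Lemma stepT_relabel c f (s : I -> I) w : bounded_mfun c f -> involutive s ->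
  stepT (fun w => f (w \o s)) w = stepT f (w \o s).
Proof.
move=> fP sK; rewrite /stepT steps_relabel//.
congr (_ _); apply: (steps_perm fP); apply: uniq_perm.
- by rewrite map_inj_uniq ?enum_uniq//; exact: can_inj sK.
- exact: enum_uniq.
- by move=> i; rewrite mem_enum -[i]sK map_f ?mem_enum.
Qed.

End Operators.

(** * Value function and the greedy rule *)

Section Value.
Context (R : realType) (dO : measure_display) (Obs : measurableType dO)
  (I : finType) (nu : {sigma_finite_measure set Obs -> \bar R}) (th : R)
  (p q : Obs -> R) (alpha : R).
Hypothesis th01 : 0 < th < 1.
Hypotheses (mp : measurable_fun setT p) (mq : measurable_fun setT q).
Hypotheses (p0 : forall x, 0 <= p x) (q0 : forall x, 0 <= q x).
Hypotheses (p1 : (\int[nu]_x (p x)%:E = 1)%E) (q1 : (\int[nu]_x (q x)%:E = 1)%E).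

Implicit Types (w : I -> R) (A B C G : {set I}).

Local Notation T := (stepT nu th p q).

(** What the exchange argument needs of a value function and what backward induction preserves.
    Symmetry is asked for transpositions only, since streams are exchanged two at a time. *)
Definition good (F : {set I} -> (I -> R) -> R) :=
  [/\ forall A, bounded_mfun #|I|%:R (F A),
      forall A B w, A \subset B -> F A w <= F B w,
      forall A, antitone_on A (F A) &
      forall i j A w, F (tperm i j @: A)%SET w = F A (w \o tperm i j)].

Lemma good_stepT F : good F -> good (fun A => T (F A)).
Proof.
move=> [Fb FS FA Fs]; split.
- by move=> A; exact: bounded_steps.
- by move=> A B w AB; apply: le_steps => //; move=> ?; exact: FS.
- by move=> A; apply: steps_antitone.
- move=> i j A w.
  have -> : F (tperm i j @: A)%SET = (fun w => F A (w \o tperm i j)).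
    by apply/funext => ?; exact: Fs.
  by apply: stepT_relabel (Fb A) _ => // k; exact: tpermK.
Qed.

(** Induction on the number of elements of [C] outside [G]: swapping one of them for a missing
    element of [G] does not lower [F], and in the end [C] lies in [G]. *)
Lemma exchange F C G w : good F -> (#|C| <= #|G|)%N ->
  (forall i j, i \in G -> j \in C :\: G -> w i <= w j) -> F C w <= F G w.
Proof.
move=> [Fb FS FA Fs]; have [n] := ubnP #|C :\: G|.
elim: n C => // n IH C nC CG wCG.
have [CsG|] := boolP (C \subset G); first exact: FS.
rewrite -finset.setD_eq0 => /set0Pn[j jCG]; have /setDP[jC jG] := jCG.
have /set0Pn[i iGC] : G :\: C != finset.set0.
  rewrite -card_gt0 -(ltn_add2l #|G :&: C|) cardsID addn0.
  apply: leq_trans CG; rewrite -(cardsID G C) finset.setIC -addn1 leq_add2l.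
  by rewrite card_gt0; apply/set0Pn; exists j.
have /setDP[iG iC] := iGC.
have ij : i != j by apply: contraNneq jG => <-.
pose C' := (tperm i j @: C)%SET.
have C'E k : (k \in C') = (tperm i j k \in C).
  by rewrite -{1}(tpermK i j k) mem_imset//; exact: perm_inj.
(* By symmetry [F C' w] is [F C] at the swapped weights; since [i] is not in [C], the swap changes
   the weights on [C] only by replacing [w j] by the smaller [w i]. *)
apply: (@le_trans _ _ (F C' w)).
  rewrite Fs; apply: FA => k kC /=; case: tpermP => [ki|->|//]; last exact: wCG.
  by rewrite -ki kC in iC.
have C'D : C' :\: G = (C :\: G) :\ j.
  apply/setP => k; rewrite !inE C'E; case: tpermP => [->|->|/eqP ki /eqP kj].
  - by rewrite iG ij.
  - by rewrite jG eqxx (negbTE iC).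
  - by rewrite kj.
apply: IH.
- by rewrite C'D; move: nC; rewrite (cardsD1 j) jCG.
- by rewrite card_imset//; exact: perm_inj.
- by move=> k l kG; rewrite C'D => /finset.setD1P[_]; exact: wCG.
Qed.

(** Multiplied out, the bound on the average needs no division and holds for the empty set. *)
Definition admissible C w := \sum_(k in C) w k <= alpha * #|C|%:R.

(** Bellman recursion: the subset is chosen from the present weights, before all streams move. The
    default 0 of the maximum is harmless because values are nonnegative. *)
Fixpoint value n A w : R :=
  if n is n'.+1 then
    \big[Num.max/0]_(C : {set I} | C \subset A)
      (if admissible C w then T (value n' C) w else 0)
  else #|A|%:R.

Lemma le_value n A C w : C \subset A -> admissible C w ->
  T (value n C) w <= value n.+1 A w.
Proof.
move=> CA aC /=; apply: le_trans (le_bigmax_cond _ _ CA); by rewrite aC.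
Qed.

Lemma value_le n A w b : 0 <= b ->
  (forall C, C \subset A -> admissible C w -> T (value n C) w <= b) ->
  value n.+1 A w <= b.
Proof. by move=> b0 H; apply: bigmax_le => // C CA; case: ifPn => // /H; exact. Qed.

Lemma value_ge0 n A w : 0 <= value n A w.
Proof. by case: n => [|n] /=; [exact: ler0n|exact: bigmax_ge_id]. Qed.

Lemma measurable_bigmax d (H : measurableType d) (J : Type) (s : seq J)
    (P : pred J) (h : J -> H -> R) :
  (forall j, measurable_fun setT (h j)) ->
  measurable_fun setT (fun x => \big[Num.max/0]_(j <- s | P j) h j x).
Proof.
move=> mh; elim: s => [|j s IH].
  by under eq_fun do rewrite big_nil; exact: measurable_cst.
under eq_fun do rewrite big_cons; case: (P j) => //.
exact: measurable_maxr.
Qed.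

Lemma sum_tperm i j C w :
  \sum_(k in (tperm i j @: C)%SET) w (tperm i j k) = \sum_(k in C) w k.
Proof.
rewrite big_imset /=; last by move=> ? ? _ _; exact: perm_inj.
by apply: eq_bigr => k _; rewrite tpermK.
Qed.

(** For antitonicity, lowering the weights on [A] keeps every admissible subset admissible and does
    not lower its continuation value. For symmetry one inequality suffices, as transpositions are
    involutions. *)
Lemma good_value n : good (value n).
Proof.
elim: n => [|n IH]; split => /=.
- move=> A; split; first by move=> *; exact: measurable_cst.
  by move=> w; rewrite ler0n ler_nat max_card.
- by move=> A B w AB; rewrite ler_nat subset_leq_card.
- by move=> A v w.
- by move=> i j A w; rewrite card_imset//; exact: perm_inj.
- move=> A; split.
    move=> d H u mu; apply: measurable_bigmax => C.
    apply: measurable_fun_ifT => //.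
    + apply: measurable_fun_ler => //.
      rewrite [X in measurable_fun _ X](_ : _ =
        (fun h => \sum_(k <- enum C) u h k)); last first.
        by apply/funext => h; rewrite big_enum.
      exact: measurable_sum.
    + by case: (good_stepT IH) => /(_ C)[+ _] _ _ _; exact.
  move=> w; rewrite -[X in 0 <= X]/(value n.+1 A w) value_ge0/=.
  apply: bigmax_le => // C CA; case: ifP => // _.
  by case: (good_stepT IH) => /(_ C)[_ /(_ w)/andP[]].
- move=> A B w AB; apply: value_le; first exact: (value_ge0 n.+1).
  by move=> C CA aC; apply: le_value => //; exact: fintype.subset_trans AB.
- move=> A v w vw; apply: value_le; first exact: (value_ge0 n.+1).
  move=> C CA aC; apply: (@le_trans _ _ (T (value n C) v)).
    case: (good_stepT IH) => _ _ + _; apply => k kC; exact: vw _ (fintype.subsetP CA _ kC).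
  apply: le_value => //; apply: le_trans aC; apply: ler_sum => k kC.
  exact: vw _ (fintype.subsetP CA _ kC).
- have tt i j (B : {set I}) : (tperm i j @: (tperm i j @: B))%SET = B.
    rewrite -finset.imset_comp -[RHS]finset.imset_id.
    by apply: eq_imset => k /=; exact: tpermK.
  suff H i j A w : value n.+1 (tperm i j @: A)%SET w <= value n.+1 A (w \o tperm i j).
    move=> i j A w; apply/eqP; rewrite eq_le H/=.
    rewrite -{1}(tt i j A) (le_trans (H _ _ _ _))//.
    suff -> : (w \o tperm i j) \o tperm i j = w by [].
    by apply/funext => k /=; rewrite tpermK.
  apply: value_le; first exact: (value_ge0 n.+1).
  move=> C CA aC; have [_ _ _ Ts] := good_stepT IH.
  rewrite -{1}(tt i j C) Ts; apply: le_value.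
    by rewrite -(tt i j A) imsetS.
  by rewrite /admissible sum_tperm card_imset//; exact: perm_inj.
Qed.

(** The properties of the update rule that optimality uses, freed from sorting and tie-breaking.
    They involve only the weights on [A], so they pass to any weights that agree there. *)
Definition greedy A w G := [/\ G \subset A, admissible G w,
  forall i j, i \in G -> j \in A :\: G -> w i <= w j &
  forall C, C \subset A -> admissible C w -> (#|C| <= #|G|)%N].

Lemma value_greedy n A w G : greedy A w G -> value n.+1 A w = T (value n G) w.
Proof.
move=> [GA aG Gmin Gmax]; apply/eqP; rewrite eq_le le_value// andbT.
have gT := good_stepT (good_value n).
apply: value_le => [|C CA aC].
  by case: gT => /(_ G)[_ /(_ w)/andP[]].
apply: (exchange (F := fun C => T (value n C))) => //; first exact: Gmax.
move=> i j iG /setDP[jC jG]; apply: Gmin => //.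
by rewrite inE jG (fintype.subsetP CA).
Qed.

Lemma sum_smallest A G C w : G \subset A -> C \subset A -> #|C| = #|G| ->
  (forall i j, i \in G -> j \in A :\: G -> w i <= w j) ->
  \sum_(k in G) w k <= \sum_(k in C) w k.
Proof.
move=> GA CA CG Gmin; rewrite (big_setID C)/= [leRHS](big_setID G)/= finset.setIC lerD2l.
have cD : #|G :\: C| = #|C :\: G|.
  by apply/eqP; rewrite -(eqn_add2l #|G :&: C|) cardsID finset.setIC cardsID CG.
(* A threshold separating the weights in [G] from those in [C :\: G]. The default lies below every
   weight in [A], so it does no harm when [G] is empty. *)
pose b := \big[Num.max/- \sum_(k in A) `|w k|]_(i in G) w i.
have bge i : i \in G -> w i <= b by move=> iG; exact: le_bigmax_cond.
have ble j : j \in C :\: G -> b <= w j.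
  move=> /setDP[jC jG]; apply: bigmax_le => [|i iG]; last first.
    by apply: Gmin => //; rewrite inE jG (fintype.subsetP CA).
  rewrite (bigD1 j) ?(fintype.subsetP CA)//= opprD lerBlDr.
  apply: (@le_trans _ _ (w j)); last by rewrite lerDl; exact: sumr_ge0.
  by rewrite lerNl (le_trans (ler_norm _))// normrN.
apply: (@le_trans _ _ (\sum_(k in G :\: C) b)).
  by apply: ler_sum => k /setDP[kG _]; exact: bge.
rewrite sumr_const cD -sumr_const; apply: ler_sum => k; exact: ble.
Qed.

End Value.

(** * The update rule is greedy *)

Lemma average_le_admissible (R : realType) K (alpha : R) (W : 'I_K -> R) (l : seq 'I_K) m :
  0 <= alpha -> uniq l -> (m <= size l)%N ->
  ((if m is 0%N then 0 else (\sum_(i <- take m l) W i) / m%:R) <= alpha) =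
  admissible alpha [set k in take m l]%SET W.
Proof.
move=> alpha0 ul ml; rewrite /admissible cardsE (card_uniqP _) ?take_uniq// size_takel//.
have -> : \sum_(k in [set k in take m l]%SET) W k = \sum_(k <- take m l) W k.
  by rewrite big_uniq ?take_uniq//; apply: eq_bigl => k; rewrite inE.
case: m ml => [|m] _; first by rewrite take0 big_nil mulr0 lexx.
by rewrite ler_pdivrMr// ltr0n.
Qed.

(** Maximality is over all admissible sets, not only initial segments of the sorted list: the
    initial segment with as many elements as an admissible set has no larger sum, hence is
    admissible, and so is no longer than the one selected. *)
Lemma update_rule_greedy (R : realType) K (alpha : R) (St : {set 'I_K})
    (W : 'I_K -> R) : 0 <= alpha ->
  greedy alpha St W (update_rule alpha St W).
Proof.
move=> alpha0.
pose r (i j : 'I_K) := (W i < W j) || ((W i == W j) && (i <= j)%N).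
pose l := sort r (enum St).
pose Rn m := if m is 0%N then 0 else (\sum_(i <- take m l) W i) / m%:R.
pose n := (\max_(n < (size l).+1 | (Rn n <= alpha)%R) (n : nat))%N.
have -> : update_rule alpha St W = [set k in take n l]%SET by [].
have rtot : total r.
  move=> i j; rewrite /r; case: (ltgtP (W i) (W j)) => //= _; exact: leq_total.
have rtrans : transitive r.
  move=> j i k; rewrite /r => /orP[ij|/andP[/eqP -> ij]] /orP[jk|/andP[/eqP <- jk]].
  - by rewrite (lt_trans ij jk).
  - by rewrite ij.
  - by rewrite jk.
  - by rewrite eqxx (leq_trans ij jk) orbT.
have rW i j : r i j -> W i <= W j.
  by rewrite /r => /orP[/ltW//|/andP[/eqP -> _]].
have ul : uniq l by rewrite sort_uniq enum_uniq.
have ml i : (i \in l) = (i \in St) by rewrite mem_sort mem_enum.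
have sl : size l = #|St| by rewrite size_sort -cardE.
have tsub m : [set k in take m l]%SET \subset St.
  by apply/fintype.subsetP => k; rewrite inE => /mem_take; rewrite ml.
have tcard m : (m <= size l)%N -> #|[set k in take m l]%SET| = m.
  by move=> ml'; rewrite cardsE (card_uniqP _) ?take_uniq// size_takel.
have tmin m i j : i \in [set k in take m l]%SET ->
    j \in St :\: [set k in take m l]%SET -> W i <= W j.
  rewrite !inE => it /andP[jt]; rewrite -ml -{1}(cat_take_drop m l) mem_cat (negbTE jt)/=.
  move=> jd; apply: rW; have : sorted r l by exact: sort_sorted.
  rewrite sorted_pairwise// -{1}(cat_take_drop m l) pairwise_cat => /andP[/allrelP + _].
  exact.
have RnE m : (m <= size l)%N ->
    (Rn m <= alpha) = admissible alpha [set k in take m l]%SET W.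
  exact: average_le_admissible.
have nle m : (m <= size l)%N -> Rn m <= alpha -> (m <= n)%N.
  rewrite -ltnS => ms Rm.
  exact: (@leq_bigmax_cond _ (fun i : 'I_(size l).+1 => Rn i <= alpha) _ (Ordinal ms)).
(* The maximum is attained because index 0 always qualifies: [Rn 0] is 0 and [alpha] is
   nonnegative. *)
have [n0 Rn0 nE] : {i : 'I_(size l).+1 | Rn i <= alpha & n = i}.
  apply: (@eq_bigmax_cond _ (fun i : 'I_(size l).+1 => Rn i <= alpha)).
  by apply/card_gt0P; exists ord0.
have ns : (n <= size l)%N by rewrite nE -ltnS.
split => //.
- by rewrite -RnE// nE.
- exact: tmin.
- move=> C CS aC; rewrite tcard//.
  have Cs : (#|C| <= size l)%N by rewrite sl subset_leq_card.
  apply: nle => //; rewrite RnE//; rewrite /admissible tcard//; apply: le_trans aC.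
  by apply: sum_smallest (tsub _) CS _ (tmin _); rewrite tcard.
Qed.

(** * Measure theory *)

Section DensityMeasure.
Context d (T : measurableType d) (R : realType) (mu : {measure set T -> \bar R})
  (g : T -> R).
Hypotheses (mg : measurable_fun setT g) (g0 : forall x, 0 <= g x).

Definition density_measure (A : set T) : \bar R := (\int[mu]_(x in A) (g x)%:E)%E.

Let density0 : density_measure set0 = 0%E.
Proof. exact: integral_set0. Qed.

Let density_ge0 A : (0 <= density_measure A)%E.
Proof. by apply: integral_ge0 => x _; rewrite lee_fin. Qed.

Let density_sigma_additive : semi_sigma_additive density_measure.
Proof.
move=> F mF tF mUF; rewrite /density_measure ge0_integral_bigcup//.
- by apply: is_cvg_nneseries => n _ _; exact: density_ge0.
- by apply/measurable_EFinP; exact: measurable_funTS.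
- by move=> x _; rewrite lee_fin.
Qed.

Definition density_mixin := isMeasure.Build _ _ _ density_measure
  density0 density_ge0 density_sigma_additive.

Definition densitym : {measure set T -> \bar R} := HB.pack density_measure density_mixin.

Lemma densitymE A : densitym A = (\int[mu]_(x in A) (g x)%:E)%E.
Proof. by []. Qed.

End DensityMeasure.

Lemma measure_fin_partition d (T : measurableType d) (R : realType)
    (mu : {measure set T -> \bar R}) (F : finType) (s : T -> F) (A : set T) :
  measurable A -> (forall a, measurable (s @^-1` [set a])) ->
  mu A = (\sum_(a : F) mu (A `&` s @^-1` [set a]))%E.
Proof.
move=> mA ms.
have {1}-> : A = \bigcup_(a in [set` index_enum F]) (A `&` s @^-1` [set a]).
  apply/seteqP; split => [x Ax|x [a _ []//]].
  by exists (s x) => //=; rewrite mem_index_enum.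
rewrite measure_fin_bigcup//.
- by rewrite -fsbig_seq// index_enum_uniq.
- by move=> a b _ _ [x [[_ <-] [_ <-]]].
- by move=> a _; exact: measurableI.
Qed.

Lemma measure_sigma_ext d (T : measurableType d) (R : realType)
    (G : set (set T)) (m1 m2 : {measure set T -> \bar R}) :
  setI_closed G -> G setT -> G `<=` measurable ->
  (m1 setT < +oo)%E -> (forall A, G A -> m1 A = m2 A) ->
  forall A, <<s G >> A -> m1 A = m2 A.
Proof.
move=> GI GT Gm m1oo m12.
apply: (g_sigma_algebra_measure_unique G Gm (fun=> setT)) => //.
by rewrite bigcup_const.
Qed.

(** Fibres are indexed by the codes [pickle] so that additivity along natural numbers applies; a
    number that is no code has an empty fibre. *)
Lemma measure_countable_partition d (T : measurableType d) (R : realType)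
    (mu : {measure set T -> \bar R}) (F : countType) (s : T -> F) (A : set T)
    (M : set F) :
  measurable A -> (forall a, measurable (s @^-1` [set a])) ->
  mu (A `&` s @^-1` M) = (\esum_(a in M) mu (A `&` s @^-1` [set a]))%E.
Proof.
move=> mA ms.
pose a j := mu (A `&` [set x | pickle (s x) = j]).
have sE m : [set x | pickle (s x) = pickle m] = s @^-1` [set m].
  by apply/seteqP; split => x /=; [exact: (pcan_inj pickleK)|move=> ->].
transitivity (\esum_(j in pickle @` M) a j)%E; last first.
  have pinj : set_inj M (@pickle F) by move=> x y _ _ /(pcan_inj pickleK).
  by rewrite (esum_image M _ a pinj); apply: eq_esum => m _; rewrite /a sE.
have ma j : measurable [set x | pickle (s x) = j].
  case: (pselect (exists m : F, pickle m = j)) => [[m <-]|nm]; first by rewrite sE.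
  rewrite [X in measurable X](_ : _ = set0)//.
  by apply/seteqP; split => x //= sx; apply: nm; exists (s x).
have -> : A `&` s @^-1` M =
    \bigcup_(j in pickle @` M) (A `&` [set x | pickle (s x) = j]).
  apply/seteqP; split => x.
    by move=> [Ax Mx]; exists (pickle (s x)) => //=; exists (s x).
  by move=> [_ [m Mm <-] [Ax /(pcan_inj pickleK) /= sx]]; split; rewrite //= sx.
rewrite measure_bigcup//=.
- by rewrite nneseries_esum//; congr esum; apply/seteqP; split => x /=; rewrite inE.
- by move=> j _; exact: measurableI.
- by move=> i j _ _ [x /= [[_ <-] [_ <-]]].
Qed.

(** [rho] and the measure of density [M] with respect to the product agree on rectangles, hence
    everywhere because [rho] is finite; Tonelli then gives the iterated integral. *)
Lemma integral_rectangle_density d1 d2 (H : measurableType d1) (Y : measurableType d2)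
  (R : realType) (lam : {sigma_finite_measure set H -> \bar R})
  (nu : {sigma_finite_measure set Y -> \bar R}) (rho : {measure set (H * Y) -> \bar R})
  (M : H * Y -> R) :
  measurable_fun setT M -> (forall z, 0 <= M z) -> (rho setT < +oo)%E ->
  (forall A B, measurable A -> measurable B ->
    rho (A `*` B) = \int[lam]_(h in A) \int[nu]_(y in B) (M (h, y))%:E)%E ->
  forall F : H * Y -> \bar R, measurable_fun setT F -> (forall z, 0 <= F z)%E ->
  (\int[rho]_z F z = \int[lam]_h \int[nu]_y (F (h, y) * (M (h, y))%:E))%E.
Proof.
move=> mM M0 rhooo rhoE F mF F0.
have mME : measurable_fun setT (EFin \o M) by exact/measurable_EFinP.
pose rho' := densitym (lam \x nu)%E mM M0.
have rr' D : measurable D -> rho D = rho' D.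
  rewrite measurable_prod_measurableType => mD.
  apply: (measure_sigma_ext (G := [set A `*` B | A in measurable & B in measurable])) => //.
  - move=> _ _ [A1 mA1 [B1 mB1 <-]] [A2 mA2 [B2 mB2 <-]]; rewrite -setXI.
    exists (A1 `&` A2); first exact: measurableI.
    by exists (B1 `&` B2) => //; exact: measurableI.
  - by exists setT => //; exists setT => //; rewrite setXTT.
  - by move=> _ [A mA [B mB <-]]; exact: measurableX.
  move=> _ [A mA [B mB <-]]; rewrite rhoE// /rho' densitymE.
  rewrite [RHS]integral_mkcond fubini_tonelli1; last 2 first.
  - by apply/(measurable_restrictT _ _).1 => //; [exact: measurableX|exact: measurable_funTS].
  - by move=> z; rewrite patchE; case: ifP => // _; rewrite lee_fin.
  rewrite [LHS]integral_mkcond; congr integral; apply/funext => h.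
  rewrite /fubini_F patchE.
  case: ifPn => hA.
    rewrite [LHS]integral_mkcond; apply: eq_integral => y _; rewrite !patchE.
    by rewrite in_setX hA.
  by rewrite integral0_eq// => y _; rewrite patchE in_setX (negbTE hA).
rewrite (@ge0_integral_density _ _ _ (lam \x nu)%E rho M F mM M0)//.
rewrite fubini_tonelli1//.
- exact: emeasurable_funM.
- by move=> z; rewrite mule_ge0 ?lee_fin.
Qed.

Section FiniteMeasure.
Context d (T : measurableType d) (R : realType) (m : {measure set T -> \bar R}).
Hypothesis mfin : fin_num_fun m.

Definition finm_fun of fin_num_fun m : set T -> \bar R := m.

HB.instance Definition _ := Measure.on (finm_fun mfin).
HB.instance Definition _ := Measure_isFinite.Build _ _ _ (finm_fun mfin) mfin.

Definition finm : {finite_measure set T -> \bar R} := finm_fun mfin.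

End FiniteMeasure.

Definition pushm d d' (T : measurableType d) (U : measurableType d') (R : realType)
  (m : {measure set T -> \bar R}) (f : T -> U) (mf : measurable_fun setT f) :
  {measure set U -> \bar R} :=
  measure_function_pushforward__canonical__measure_function_Measure m mf.

Lemma measurable_fun_subsigma d d' (T : measurableType d) (U : measurableType d')
    (G : set (set T)) (f : T -> U) : <<s G >> `<=` measurable ->
  measurable_fun setT (f : g_sigma_algebraType G -> U) -> measurable_fun setT f.
Proof.
move=> Gm mf _ B mB; rewrite setTI; apply: Gm.
by have := mf measurableT B mB; rewrite setTI.
Qed.

(** [M] acts as a conditional density of [Y] given the sigma-algebra generated by [G]. Viewing the
    identity as a map onto [T] with that smaller sigma-algebra places the pair [(w, Y w)] in a
    product space, where rectangles determine its law. *)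
Lemma integral_history d d' (T : measurableType d) (U : measurableType d') (R : realType)
    (P : {finite_measure set T -> \bar R}) (nu : {sigma_finite_measure set U -> \bar R})
    (G : set (set T)) (Y : T -> U) (M : g_sigma_algebraType G * U -> R) :
  <<s G >> `<=` measurable -> measurable_fun setT Y ->
  measurable_fun setT M -> (forall z, 0 <= M z) ->
  (forall C B, <<s G >> C -> measurable B ->
    P (C `&` Y @^-1` B) = \int[P]_(w in C) \int[nu]_(y in B) (M (w, y))%:E)%E ->
  forall F : g_sigma_algebraType G * U -> \bar R,
  measurable_fun setT F -> (forall z, 0 <= F z)%E ->
  (\int[P]_w F (w, Y w) = \int[P]_w \int[nu]_y (F (w, y) * (M (w, y))%:E))%E.
Proof.
move=> Gm mY mM M0 PE F mF F0.
pose H := g_sigma_algebraType G.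
have mid : measurable_fun setT (id : T -> H).
  by move=> _ B mB; rewrite setTI; exact: Gm.
pose phi (w : T) : H * U := (w, Y w).
have mphi : measurable_fun setT phi by exact/measurable_fun_pairP.
pose lam0 : {measure set H -> \bar R} := pushm P mid.
have lam0fin : fin_num_fun lam0.
  by move=> A mA; rewrite /lam0/= /pushforward fin_num_measure//; exact: Gm.
pose lam : {finite_measure set H -> \bar R} := finm lam0fin.
pose rho : {measure set (H * U) -> \bar R} := pushm P mphi.
have lamE D (f : H -> \bar R) : measurable D -> measurable_fun D f ->
    {in D, forall y, 0 <= f y}%E -> (\int[lam]_(h in D) f h = \int[P]_(w in D) f w)%E.
  by move=> mD mf f0; rewrite (ge0_integral_pushforward mid).
have mI B : measurable B ->
    measurable_fun setT (fun h : H => \int[nu]_(y in B) (M (h, y))%:E)%E.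
  move=> mB.
  have := @measurable_fun_fubini_tonelli_F _ _ H U R nu
    (fun z => ((M z)%:E * (\1_B z.2)%:E)%E).
  rewrite /fubini_F/=.
  rewrite [X in _ -> _ -> measurable_fun _ X](_ : _ =
    (fun h : H => \int[nu]_(y in B) (M (h, y))%:E)%E); last first.
    apply/funext => h; rewrite [RHS]integral_mkcond; apply: eq_integral => y _.
    by rewrite epatch_indic.
  apply.
    apply: emeasurable_funM; first exact/measurable_EFinP.
    apply/measurable_EFinP; apply: measurableT_comp => //; exact: measurable_indic.
  by move=> z; rewrite mule_ge0 ?lee_fin.
transitivity (\int[rho]_z F z)%E.
  by rewrite /rho (ge0_integral_pushforward mphi).
rewrite (@integral_rectangle_density _ _ _ _ _ lam nu rho M)//.
- rewrite lamE//; last by move=> h _; apply: integral_ge0 => y _; rewrite mule_ge0 ?lee_fin.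
  apply: (@measurable_fun_fubini_tonelli_F _ _ H U R nu (fun z => F z * (M z)%:E)%E).
    by apply: emeasurable_funM => //; exact/measurable_EFinP.
  by move=> z; rewrite mule_ge0 ?lee_fin.
- by rewrite -ge0_fin_numE// /rho/= /pushforward fin_num_measure// preimage_setT.
- move=> A B mA mB; rewrite lamE//.
  + by rewrite -PE.
  + exact: measurable_funTS (mI _ mB).
  + by move=> h _; apply: integral_ge0 => y _; rewrite lee_fin.
Qed.

(** * Posterior given the full history *)

Section Posterior.
Context (R : realType) (d dO : measure_display) (Omega : measurableType d)
  (Obs : measurableType dO) (P : probability Omega R)
  (nu : {sigma_finite_measure set Obs -> \bar R}) (K : nat) (th : R) (p q : Obs -> R)
  (tau : 'I_K -> Omega -> option nat) (X : 'I_K -> nat -> Omega -> Obs).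
Hypothesis th01 : 0 < th < 1.
Hypotheses (mp : measurable_fun setT p) (mq : measurable_fun setT q).
Hypotheses (p0 : forall x, 0 <= p x) (q0 : forall x, 0 <= q x).
Hypotheses (p1 : (\int[nu]_x (p x)%:E = 1)%E) (q1 : (\int[nu]_x (q x)%:E = 1)%E).
Hypothesis mtau : forall k m, measurable [set w | tau k w = m].
Hypothesis mX : forall k t, measurable_fun setT (X k t).
Hypothesis law : forall (n : nat) (m : 'I_K -> option nat) (B : 'I_K -> nat -> set Obs),
  (forall k s, measurable (B k s)) ->
  P [set w | (forall k, tau k w = m k) /\
             (forall k s, (0 < s <= n)%N -> B k s (X k s w))]
  = ((\prod_(k < K) (geom_pmf th (m k))%:E) *
     \prod_(k < K) \prod_(1 <= s < n.+1)
       \int[nu]_(x in B k s) (obs_dens p q (m k) s x)%:E)%E.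

Implicit Types (n : 'I_K -> nat) (B : 'I_K -> nat -> set Obs) (j k : 'I_K)
  (m : {ffun 'I_K -> option nat}) (e : {ffun 'I_K -> bool}) (C D : set Omega).

(* [n k] is the number of observations of stream [k] seen so far. *)
Definition cyl n B : set Omega :=
  [set w | forall k s, (0 < s <= n k)%N -> B k s (X k s w)].

Definition cyls n : set (set Omega) :=
  [set A | exists B, (forall k s, measurable (B k s)) /\ A = cyl n B].

Definition incr n j : 'I_K -> nat := fun k => (n k + (k == j))%N.

Definition tauv (w : Omega) : {ffun 'I_K -> option nat} := [ffun k => tau k w].

Definition lik (o : option nat) s (B : set Obs) : \bar R :=
  (\int[nu]_(x in B) (obs_dens p q o s x)%:E)%E.

Lemma dens_ge0 o s x : 0 <= obs_dens p q o s x.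
Proof. by rewrite /obs_dens; case: cp_lt. Qed.

Lemma measurable_dens o s : measurable_fun setT (obs_dens p q o s).
Proof. by rewrite /obs_dens; case: cp_lt. Qed.

Definition dens1 (b : bool) : Obs -> R := if b then q else p.

Lemma dens1_ge0 b x : 0 <= dens1 b x.
Proof. by rewrite /dens1; case: b. Qed.

Lemma measurable_dens1 b : measurable_fun setT (dens1 b).
Proof. by rewrite /dens1; case: b. Qed.

Lemma lik_setT o s : lik o s setT = 1%E.
Proof. by rewrite /lik /obs_dens; case: cp_lt. Qed.

Lemma lik_ge0 o s (B : set Obs) : (0 <= lik o s B)%E.
Proof. by apply: integral_ge0 => x _; rewrite lee_fin dens_ge0. Qed.

Lemma lik_fin o s (B : set Obs) : measurable B -> lik o s B \is a fin_num.
Proof.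
move=> mB; rewrite ge0_fin_numE ?lik_ge0//.
apply: (@le_lt_trans _ _ (lik o s setT)); last by rewrite lik_setT ltry.
apply: ge0_subset_integral => //.
- by apply/measurable_EFinP; exact: measurable_dens.
- by move=> x _; rewrite lee_fin dens_ge0.
Qed.

Lemma measurable_tauv m : measurable (tauv @^-1` [set m]).
Proof.
rewrite (_ : _ @^-1` _ = \bigcap_(k in [set: 'I_K]) [set w | tau k w = m k]).
  by apply: fin_bigcap_measurable => // k _; exact: mtau.
apply/seteqP; split => w /=; first by move=> <- k _; rewrite /= ffunE.
by move=> tw; apply/ffunP => k; rewrite ffunE; exact: tw.
Qed.

Lemma measurable_preX j s (B : set Obs) : measurable B -> measurable (X j s @^-1` B).
Proof. by move=> mB; rewrite -[X in measurable X]setTI; exact: mX. Qed.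

Lemma law_cyl n m B : (forall k s, measurable (B k s)) ->
  P (cyl n B `&` tauv @^-1` [set m]) = ((\prod_(k < K) (geom_pmf th (m k))%:E) *
     (* Uneven counts are padded to a common horizon by unconstrained observations, each of which
        contributes a factor one. *)
     \prod_(k < K) \prod_(1 <= s < (n k).+1) lik (m k) s (B k s))%E.
Proof.
move=> mB; pose N := (\max_k n k)%N.
pose B' k s := if (s <= n k)%N then B k s else setT.
have mB' k s : measurable (B' k s) by rewrite /B'; case: ifP.
have nN k : (n k <= N)%N by exact: leq_bigmax.
rewrite (_ : _ `&` _ = [set w | (forall k, tau k w = m k) /\
             (forall k s, (0 < s <= N)%N -> B' k s (X k s w))]).
  rewrite law//; congr (_ * _)%E; apply: eq_bigr => k _.
  rewrite (@big_cat_nat _ _ _ (n k).+1)//= ?ltnS//.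
  rewrite [X in (_ * X)%E]big1_seq ?mule1.
    by apply: eq_big_nat => s /andP[_]; rewrite ltnS /B' => ->.
  move=> s /=; rewrite mem_index_iota => /andP[ns _].
  by rewrite /B' leqNgt ns -[LHS]/(lik _ _ _) lik_setT.
apply/seteqP; split => w /=.
  move=> [wB <-]; split => [k|k s /andP[s0 sN]]; first by rewrite ffunE.
  by rewrite /B'; case: ifPn => // sn; apply: wB; rewrite s0.
move=> [tw wB]; split; last by apply/ffunP => k; rewrite ffunE.
move=> k s /andP[s0 sn]; have := wB k s; rewrite s0 (leq_trans sn (nN _)) /B' sn.
exact.
Qed.

Lemma cyls_setI n : setI_closed (cyls n).
Proof.
move=> _ _ [B1 [mB1 ->]] [B2 [mB2 ->]].
exists (fun k s => B1 k s `&` B2 k s); split; first by move=> k s; exact: measurableI.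
apply/seteqP; split => w /=.
  by move=> [w1 w2] k s ks; split; [exact: w1|exact: w2].
by move=> w12; split => k s /w12[].
Qed.

Lemma cyls_setT n : cyls n setT.
Proof. by exists (fun _ _ => setT); split => //; apply/seteqP; split. Qed.

Lemma cyls_measurable n : cyls n `<=` measurable.
Proof.
move=> _ [B [mB ->]].
rewrite (_ : cyl n B = \bigcap_(k in [set: 'I_K])
    \bigcap_(s in [set s | (0 < s <= n k)%N]) (X k s @^-1` B k s)).
  apply: fin_bigcap_measurable => // k _; apply: bigcap_measurableType => s _.
  exact: measurable_preX.
apply/seteqP; split => w /= wB.
  by move=> k _ s ks; exact: wB.
by move=> k s ks; exact: wB.
Qed.

Lemma sigma_cyls_measurable n : <<s cyls n >> `<=` measurable.
Proof.
by apply: smallest_sub; [exact: sigma_algebra_measurable|exact: cyls_measurable].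
Qed.

Lemma cyl_incrE n j B :
  cyl (incr n j) B = cyl n B `&` X j (n j).+1 @^-1` B j (n j).+1.
Proof.
apply/seteqP; split => w /=.
  move=> wB; split; last by apply: wB; rewrite /incr eqxx addn1 leqnn.
  by move=> k s /andP[s0 sn]; apply: wB; rewrite s0 /incr (leq_trans sn)// leq_addr.
move=> [wB wX] k s /andP[s0]; rewrite /incr; have [->|kj] := eqVneq k j.
  rewrite addn1 leq_eqVlt => /orP[/eqP -> //|]; rewrite ltnS => sn.
  by apply: wB; rewrite s0.
by rewrite addn0 => sn; apply: wB; rewrite s0.
Qed.

Lemma cyl_incr n j B (B0 : set Obs) : (forall k s, measurable (B k s)) ->
  measurable B0 -> exists B', [/\ forall k s, measurable (B' k s),
    cyl n B `&` X j (n j).+1 @^-1` B0 = cyl (incr n j) B',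
    B' j (n j).+1 = B0 &
    forall k s, (k != j) || (s <= n k)%N -> B' k s = B k s].
Proof.
move=> mB mB0.
pose B' k s := if (k == j) && (s == (n j).+1) then B0 else B k s.
have B'E k s : (k != j) || (s <= n k)%N -> B' k s = B k s.
  by rewrite /B'; case: eqP => //= -> sn; rewrite ltn_eqF.
have B'j : B' j (n j).+1 = B0 by rewrite /B' !eqxx.
exists B'; split => //; first by move=> k s; rewrite /B'; case: ifP.
rewrite cyl_incrE B'j; congr (_ `&` _); apply/seteqP; split => w /= wB k s ks.
  by rewrite B'E; [exact: wB|case/andP: ks => _ ->; rewrite orbT].
by rewrite -B'E; [exact: wB|case/andP: ks => _ ->; rewrite orbT].
Qed.

Lemma obs_given_tau_cyl n m j B (B0 : set Obs) : (forall k s, measurable (B k s)) ->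
  measurable B0 ->
  P (cyl n B `&` X j (n j).+1 @^-1` B0 `&` tauv @^-1` [set m]) =
  (lik (m j) (n j).+1 B0 * P (cyl n B `&` tauv @^-1` [set m]))%E.
Proof.
move=> mB mB0; have [B' [mB' -> B'j B'E]] := cyl_incr n j mB mB0.
rewrite !law_cyl// muleCA; congr (_ * _)%E.
rewrite (bigD1 j)//= [in RHS](bigD1 j)//= muleA; congr (_ * _)%E.
  rewrite /incr eqxx addn1 big_nat_recr//= B'j muleC; congr (_ * _)%E.
  by apply: eq_big_nat => s /andP[_]; rewrite ltnS => sn; rewrite B'E ?sn ?orbT.
apply: eq_bigr => k kj; rewrite /incr (negbTE kj) addn0.
by apply: eq_bigr => s _; rewrite B'E ?kj.
Qed.

(** As functions of [C] both sides are finite measures, so agreement on the intersection-stable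
    family of cylinders is enough. *)
Lemma sigma_cyls_ext n (D1 D2 : set Omega) (c : \bar R) C :
  measurable D1 -> measurable D2 -> (0 <= c)%E -> c \is a fin_num ->
  (forall B, (forall k s, measurable (B k s)) ->
     P (cyl n B `&` D1) = (c * P (cyl n B `&` D2))%E) ->
  <<s cyls n >> C -> P (C `&` D1) = (c * P (C `&` D2))%E.
Proof.
move=> mD1 mD2 c0 cfin H nC.
have c0' : 0 <= fine c by exact: fine_ge0.
have -> : P (C `&` D1) = mrestr P mD1 C by [].
rewrite (@measure_sigma_ext _ _ _ (cyls n) _ (mscale (NngNum c0') (mrestr P mD2)))//.
- by rewrite /= /mscale /mrestr /= fineK.
- exact: cyls_setI.
- exact: cyls_setT.
- exact: cyls_measurable.
- by rewrite /= /mrestr -ge0_fin_numE// fin_num_measure//; exact: measurableI.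
- by move=> _ [B [mB ->]]; rewrite /= /mscale /mrestr /= fineK//; exact: H.
Qed.

Lemma obs_given_tau n m j (B0 : set Obs) C : measurable B0 -> <<s cyls n >> C ->
  P (C `&` X j (n j).+1 @^-1` B0 `&` tauv @^-1` [set m]) =
  (lik (m j) (n j).+1 B0 * P (C `&` tauv @^-1` [set m]))%E.
Proof.
move=> mB0 nC; rewrite -setIA; apply: (sigma_cyls_ext _ _ _ _ _ nC).
- by apply: measurableI; [exact: measurable_preX|exact: measurable_tauv].
- exact: measurable_tauv.
- exact: lik_ge0.
- exact: lik_fin.
- by move=> B mB; rewrite setIA; exact: obs_given_tau_cyl.
Qed.

Definition delay j m : {ffun 'I_K -> option nat} :=
  [ffun k => if k == j then omap S (m j) else m k].

(** Memorylessness: postponing a change that has not hit the observations seen leaves their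
    likelihood intact and multiplies the geometric weight by [1 - th]. At [None] both sides are
    0. *)
Lemma delay_law n m j C : ~~ cp_lt (m j) (n j) -> <<s cyls n >> C ->
  P (C `&` tauv @^-1` [set delay j m]) = ((1 - th)%:E * P (C `&` tauv @^-1` [set m]))%E.
Proof.
case/andP: th01 => t0 t1.
move=> mn nC; apply: (sigma_cyls_ext _ _ _ _ _ nC) => //.
- exact: measurable_tauv.
- exact: measurable_tauv.
- by rewrite lee_fin subr_ge0 ltW.
move=> B mB; rewrite !law_cyl// muleA; congr (_ * _)%E.
  rewrite (bigD1 j)//= [in RHS](bigD1 j)//= muleA; congr (_ * _)%E.
    rewrite ffunE eqxx -EFinM; congr EFin; case: (m j) => [i|] /=; last by rewrite mulr0.
    by rewrite exprS mulrCA.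
  by apply: eq_bigr => k kj; rewrite ffunE (negbTE kj).
apply: eq_bigr => k _; rewrite ffunE; case: eqP => // ->.
apply: eq_big_nat => s /andP[_]; rewrite ltnS => sn.
rewrite /lik; apply: eq_integral => x _; rewrite /obs_dens.
case: (m j) mn => //= i; rewrite -leqNgt => ni.
by rewrite !ltnNge (leq_trans sn ni) (leq_trans sn (leqW ni)).
Qed.

(* [st n w k] tells whether the change in stream [k] has hit the observations
   seen so far, i.e. whether [tau_k < n_k]. *)
Definition st n (w : Omega) : {ffun 'I_K -> bool} := [ffun k => cp_lt (tau k w) (n k)].

Definition stv n e : set {ffun 'I_K -> option nat} :=
  [set m | forall k, cp_lt (m k) (n k) = e k].

Lemma st_tauv n e : st n @^-1` [set e] = tauv @^-1` stv n e.
Proof.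
apply/seteqP; split => w /=.
  by move=> <- k; rewrite !ffunE.
by move=> tw; apply/ffunP => k; rewrite -tw !ffunE.
Qed.

Lemma measurable_changed t k : measurable [set w | cp_lt (tau k w) t].
Proof.
rewrite (_ : [set w | _] =
    \bigcup_o ([set w | tau k w = o] `&` [set w | cp_lt o t])).
  apply: countable_bigcupT_measurable => // o; apply: measurableI => //.
  case: (cp_lt o t); first by rewrite (_ : [set _ | _] = setT)//; apply/seteqP; split.
  by rewrite (_ : [set _ | _] = set0)//; apply/seteqP; split.
apply/seteqP; split => w /=; first by move=> te; exists (tau k w).
by case=> o _ [-> ].
Qed.

Lemma measurable_st n e : measurable (st n @^-1` [set e]).
Proof.
rewrite (_ : _ @^-1` _ =
    \bigcap_(k in [set: 'I_K]) [set w | cp_lt (tau k w) (n k) = e k]).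
  apply: fin_bigcap_measurable => // k _; case: (e k).
    exact: measurable_changed.
  rewrite (_ : [set w | _] = ~` [set w | cp_lt (tau k w) (n k)]).
    exact/measurableC/measurable_changed.
  by apply/seteqP; split => w /=; [move=> ->|move/negP/negbTE].
apply/seteqP; split => w /=; first by move=> <- k _; rewrite /= ffunE.
by move=> tw; apply/ffunP => k; rewrite ffunE; exact: tw.
Qed.

Definition setj e j b : {ffun 'I_K -> bool} := [ffun k => if k == j then b else e k].

Definition lik1 (b : bool) (B : set Obs) : \bar R :=
  (\int[nu]_(x in B) (dens1 b x)%:E)%E.

(** The new observation has index [(n j).+1], and its density depends on the change points only
    through whether [tau j] is below that index, which is the state after the increment. *)
Lemma obs_given_st n e j (B0 : set Obs) C : measurable B0 -> <<s cyls n >> C ->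
  P (C `&` X j (n j).+1 @^-1` B0 `&` st (incr n j) @^-1` [set e]) =
  (lik1 (e j) B0 * P (C `&` st (incr n j) @^-1` [set e]))%E.
Proof.
move=> mB0 nC; have mC := sigma_cyls_measurable nC.
rewrite st_tauv measure_countable_partition; last 2 first.
- by apply: measurableI => //; exact: measurable_preX.
- exact: measurable_tauv.
have lE b : lik1 b B0 = lik (if b then Some 0%N else None) 1 B0.
  by rewrite /lik1 /lik /dens1 /obs_dens; case: b.
have l0 : 0 <= fine (lik1 (e j) B0) by rewrite fine_ge0// lE lik_ge0.
have lfin : lik1 (e j) B0 \is a fin_num by rewrite lE lik_fin.
have := measure_countable_partition (mscale (NngNum l0) P) (stv (incr n j) e) mC measurable_tauv.
rewrite /= /mscale /= fineK// => ->.
apply: eq_esum => m me; rewrite obs_given_tau//; congr (_ * _)%E.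
by rewrite /lik /lik1 /dens1 /obs_dens -(me j) /incr eqxx addn1.
Qed.

(** [delay j] is a bijection between the change-point vectors in state [e] before and after the
    increment. For surjectivity, a change time not yet reached after the increment is positive and
    has a predecessor. *)
Lemma no_change_yet n e j C : e j = false -> <<s cyls n >> C ->
  P (C `&` st (incr n j) @^-1` [set e]) =
  ((1 - th)%:E * P (C `&` st n @^-1` [set e]))%E.
Proof.
case/andP: th01 => t0 t1 ej nC; have mC := sigma_cyls_measurable nC.
have t10 : 0 <= 1 - th by rewrite subr_ge0 ltW.
rewrite !st_tauv measure_countable_partition//; last exact: measurable_tauv.
have := measure_countable_partition (mscale (NngNum t10) P) (stv n e) mC measurable_tauv.
rewrite /= /mscale /= => ->.
rewrite (reindex_esum (stv n e) _ (delay j)).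
  by apply: eq_esum => m me; rewrite (delay_law _ nC)// me ej.
split.
- move=> m me k; rewrite /delay ffunE /incr; have [->|kj] := eqVneq k j.
    by have := me j; case: (m j) => //= i; rewrite addn1 ltnS.
  by rewrite addn0 me.
- move=> m m' me m'e /ffunP mm; apply/ffunP => k; have := mm k; rewrite !ffunE.
  by case: eqP => // ->; case: (m j) (m' j) => [a|] [b|] //= [->].
- move=> m me; exists [ffun k => if k == j then omap predn (m j) else m k].
    move=> k; rewrite ffunE; have := me k; rewrite /incr; have [->|kj] := eqVneq k j.
      rewrite addn1 ej; case: (m j) => //= i; rewrite ltnS => /negbT.
      rewrite -ltnNge => ni; apply/negbTE; rewrite -leqNgt -ltnS prednK//.
      exact: leq_ltn_trans ni.
    by rewrite addn0.
  apply/ffunP => k; rewrite !ffunE eqxx; case: eqP => // ->.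
  have := me j; rewrite /incr eqxx addn1 ej; case: (m j) => //= i.
  by rewrite ltnS => /negbT; rewrite -ltnNge => ni; rewrite prednK// (leq_ltn_trans _ ni).
Qed.

(** Merging the two states of stream [j] leaves an event about the other streams, whose counts are
    unaltered. This yields the changed state from the unchanged one by subtraction. *)
Lemma change_split n e j C : measurable C ->
  (P (C `&` st (incr n j) @^-1` [set setj e j true]) +
   P (C `&` st (incr n j) @^-1` [set setj e j false]) =
   P (C `&` st n @^-1` [set setj e j true]) +
   P (C `&` st n @^-1` [set setj e j false]))%E.
Proof.
move=> mC.
have D n' : (P (C `&` st n' @^-1` [set setj e j true]) +
    P (C `&` st n' @^-1` [set setj e j false]) =
    P (C `&` [set w | forall k, k != j -> cp_lt (tau k w) (n' k) = e k]))%E.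
  rewrite -measureU.
  - congr (P _); apply/seteqP; split => w /=.
      by move=> [[Cw /ffunP se]|[Cw /ffunP se]]; split => // k kj;
        have := se k; rewrite !ffunE (negbTE kj).
    move=> [Cw se]; case E : (cp_lt (tau j w) (n' j)); [left|right]; split => //;
      apply/ffunP => k; rewrite !ffunE; have [->//|kj] := eqVneq k j; exact: se.
  - by apply: measurableI => //; exact: measurable_st.
  - by apply: measurableI => //; exact: measurable_st.
  - apply/seteqP; split => w //= [[_ /ffunP/(_ j)] + [_ /ffunP/(_ j)]].
    by rewrite !ffunE eqxx => ->.
rewrite !D; congr (P (_ `&` _)); apply/seteqP; split => w /= se k kj;
by have := se k kj; rewrite /incr (negbTE kj) addn0.
Qed.

(** The Bayes filter of one stream. It starts at 0 because no change point lies below 0; a change at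
    time 0 enters through the first [prior]. *)
Fixpoint wk k (t : nat) (w : Omega) : R :=
  if t is t'.+1 then obs_upd th p q (wk k t' w) (X k t w) else 0.

Lemma wk_itv k t w : 0 <= wk k t w <= 1.
Proof. by case: t => [|t] /=; [rewrite lexx ler01|exact: obs_upd_itv]. Qed.

Local Notation hist n := (g_sigma_algebraType (cyls n)).

Lemma measurable_hist_X n k s : (0 < s <= n k)%N ->
  measurable_fun setT (X k s : hist n -> Obs).
Proof.
move=> ks _ B mB; rewrite setTI; apply: sub_sigma_algebra.
exists (fun k' s' => if (k' == k) && (s' == s) then B else setT); split.
  by move=> k' s'; case: ifP.
apply/seteqP; split => w /=.
  by move=> Bw k' s' _; case: ifP => // /andP[/eqP -> /eqP ->].
by move=> /(_ _ _ ks); rewrite !eqxx.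
Qed.

Lemma measurable_hist_wk n k t : (t <= n k)%N ->
  measurable_fun setT (wk k t : hist n -> R).
Proof.
elim: t => [|t IH] tn /=; first exact: measurable_cst.
by apply: measurable_obs_upd => //; [exact: IH (ltnW tn)|exact: measurable_hist_X].
Qed.

Lemma measurable_wk k t : measurable_fun setT (wk k t).
Proof.
apply: (@measurable_fun_subsigma _ _ _ _ (cyls (fun=> t))).
  exact: sigma_cyls_measurable.
exact: measurable_hist_wk.
Qed.

Definition wprob (b : bool) (w : R) : R := if b then w else 1 - w.

Lemma wprob_ge0 b w : 0 <= w <= 1 -> 0 <= wprob b w.
Proof. by move=> /andP[w0 w1]; case: b; rewrite /= ?subr_ge0. Qed.

Lemma measurable_wprob d' (T : measurableType d') (b : bool) (f : T -> R) :
  measurable_fun setT f -> measurable_fun setT (fun x => wprob b (f x)).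
Proof. by move=> mf; case: b => //=; apply: measurable_funB. Qed.

(* Joint posterior of the states: given the history, they are independent. *)
Definition joint n e (w : Omega) : R := \prod_(k < K) wprob (e k) (wk k (n k) w).

Definition others n e j (w : Omega) : R :=
  \prod_(k < K | k != j) wprob (e k) (wk k (n k) w).

Lemma joint_others n e j w :
  joint n e w = wprob (e j) (wk j (n j) w) * others n e j w.
Proof. by rewrite /joint (bigD1 j). Qed.

Lemma joint_ge0 n e w : 0 <= joint n e w.
Proof. by apply: prodr_ge0 => k _; rewrite wprob_ge0// wk_itv. Qed.

Lemma others_ge0 n e j w : 0 <= others n e j w.
Proof. by apply: prodr_ge0 => k _; rewrite wprob_ge0// wk_itv. Qed.

Lemma measurable_hist_others n e j :
  measurable_fun setT (others n e j : hist n -> R).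
Proof.
rewrite /others; under eq_fun do rewrite -big_filter.
apply: measurable_prod => k _; apply: measurable_wprob; exact: measurable_hist_wk.
Qed.

Lemma measurable_hist_joint n e : measurable_fun setT (joint n e : hist n -> R).
Proof.
apply: measurable_prod => k _; apply: measurable_wprob; exact: measurable_hist_wk.
Qed.

Lemma measurable_others n e j : measurable_fun setT (others n e j).
Proof.
apply: (@measurable_fun_subsigma _ _ _ _ (cyls n)).
  exact: sigma_cyls_measurable.
exact: measurable_hist_others.
Qed.

Lemma measurable_joint n e : measurable_fun setT (joint n e).
Proof.
apply: (@measurable_fun_subsigma _ _ _ _ (cyls n)).
  exact: sigma_cyls_measurable.
exact: measurable_hist_joint.
Qed.

Definition posterior_ok n := forall e C, <<s cyls n >> C ->
  P (C `&` st n @^-1` [set e]) = (\int[P]_(w in C) (joint n e w)%:E)%E.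

Lemma posterior0 : posterior_ok (fun=> 0%N).
Proof.
move=> e C nC; have mC := sigma_cyls_measurable nC.
have st0 w : st (fun=> 0%N) w = [ffun=> false].
  by apply/ffunP => k; rewrite !ffunE; case: (tau k w).
have [->|e0] := eqVneq e [ffun=> false].
  rewrite (_ : _ @^-1` _ = setT) ?setIT; last by apply/seteqP; split => w /=.
  under eq_integral => w _.
    rewrite /joint big1 => [|k _]; last by rewrite ffunE /= subr0.
    over.
  by rewrite integral_cst// mul1e.
rewrite (_ : _ @^-1` _ = set0) ?setI0 ?measure0; last first.
  by apply/seteqP; split => // w /=; rewrite st0 => /esym/eqP; rewrite (negbTE e0).
have [k ek] : exists k, e k.
  apply/existsP; apply: contraNT e0 => /existsPn ek; apply/eqP/ffunP => k.
  by rewrite ffunE; exact/negbTE/ek.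
rewrite integral0_eq// => w _; rewrite (joint_others _ _ k) ek /=.
by rewrite mul0r.
Qed.

Lemma wprob_prior_false k t w : wprob false (prior th (wk k t w)) =
  (1 - th) * (1 - wk k t w).
Proof. by rewrite /= /prior clip_id ?wk_itv//; ring. Qed.

Lemma wprob_prior_ge0 b w : 0 <= wprob b (prior th w).
Proof. by rewrite wprob_ge0// prior01. Qed.

Lemma measurable_wprob_prior b k t :
  measurable_fun setT (fun w => wprob b (prior th (wk k t w))).
Proof. apply: measurable_wprob; apply: measurable_prior; exact: measurable_wk. Qed.

(** Prediction before the new observation. If stream [j] is unchanged this is memorylessness; if it
    has changed, the probability follows by subtraction, legitimate because all terms are finite. *)
Lemma next_state n e j C : posterior_ok n -> <<s cyls n >> C ->
  P (C `&` st (incr n j) @^-1` [set e]) =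
  (\int[P]_(w in C) (others n e j w * wprob (e j) (prior th (wk j (n j) w)))%:E)%E.
Proof.
move=> nP nC; have mC := sigma_cyls_measurable nC.
have mO e' : measurable_fun C (fun w =>
    (others n e' j w * wprob (e' j) (prior th (wk j (n j) w)))%:E).
  apply: measurable_funTS; apply/measurable_EFinP; apply: measurable_funM.
    exact: measurable_others.
  exact: measurable_wprob_prior.
have O0 e' w : (0 <= (others n e' j w * wprob (e' j) (prior th (wk j (n j) w)))%:E)%E.
  by rewrite lee_fin mulr_ge0 ?others_ge0 ?wprob_prior_ge0.
have mJ e' : measurable_fun C (fun w => (joint n e' w)%:E).
  by apply: measurable_funTS; apply/measurable_EFinP; exact: measurable_joint.
have J0 e' w : (0 <= (joint n e' w)%:E)%E by rewrite lee_fin joint_ge0.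
have H e' : e' j = false -> P (C `&` st (incr n j) @^-1` [set e']) =
    (\int[P]_(w in C) (others n e' j w * wprob (e' j) (prior th (wk j (n j) w)))%:E)%E.
  move=> ej; rewrite (no_change_yet ej nC) nP// -ge0_integralZl//; last first.
    by case/andP: th01 => t0 t1; rewrite lee_fin subr_ge0 ltW.
  apply: eq_integral => w _; rewrite -EFinM ej wprob_prior_false.
  by rewrite (joint_others _ _ j) ej /=; congr EFin; ring.
case ej : (e j); last by rewrite H// ej.
pose e0 := setj e j false.
have e0j : e0 j = false by rewrite /e0 ffunE eqxx.
have eE : setj e j true = e.
  by apply/ffunP => k; rewrite ffunE; case: eqP => // ->.
have := change_split n e j mC; rewrite eE -/e0 !nP// (H e0)// -!ge0_integralD//.
rewrite (eq_integral (fun w => (others n e j w * wprob (e j) (prior th (wk j (n j) w)))%:E +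
    (others n e0 j w * wprob (e0 j) (prior th (wk j (n j) w)))%:E)%E); last first.
  move=> w _; rewrite -!EFinD !(joint_others _ _ j) ej e0j /=; congr EFin.
  have -> : others n e0 j w = others n e j w.
    by apply: eq_bigr => k kj; rewrite /e0 ffunE (negbTE kj).
  by ring.
rewrite ge0_integralD// ej.
set b := (\int[P]_(w in C) (others n e0 j w * _)%:E)%E.
have bfin : b \is a fin_num.
  by rewrite /b -H// fin_num_measure//; apply: measurableI => //; exact: measurable_st.
by move=> /(congr1 (fun z => z - b)%E); rewrite !addeK.
Qed.

Lemma obs_state n e j C (B0 : set Obs) : posterior_ok n -> <<s cyls n >> C ->
  measurable B0 ->
  P (C `&` X j (n j).+1 @^-1` B0 `&` st (incr n j) @^-1` [set e]) =
  (\int[P]_(w in C) \int[nu]_(x in B0)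
     (others n e j w * (wprob (e j) (prior th (wk j (n j) w)) * dens1 (e j) x))%:E)%E.
Proof.
move=> nP nC mB0; have mC := sigma_cyls_measurable nC.
rewrite obs_given_st// (next_state _ _ nP nC) -ge0_integralZl//; last 3 first.
- apply: measurable_funTS; apply/measurable_EFinP; apply: measurable_funM.
    exact: measurable_others.
  exact: measurable_wprob_prior.
- by move=> w _; rewrite lee_fin mulr_ge0 ?others_ge0 ?wprob_prior_ge0.
- by apply: integral_ge0 => x _; rewrite lee_fin dens1_ge0.
apply: eq_integral => w _.
rewrite muleC -[in LHS]ge0_integralZl//; last 3 first.
- by apply: measurable_funTS; apply/measurable_EFinP; exact: measurable_dens1.
- by move=> x _; rewrite lee_fin dens1_ge0.
- by rewrite lee_fin mulr_ge0 ?others_ge0 ?wprob_prior_ge0.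
by apply: eq_integral => x _; rewrite -EFinM mulrA.
Qed.

(** The sum of products over joint states is a product of two-term sums; every stream other than [j]
    contributes one. *)
Lemma sum_states n j w x :
  \sum_(e : {ffun 'I_K -> bool})
     others n e j w * (wprob (e j) (prior th (wk j (n j) w)) * dens1 (e j) x) =
  obs_mix th p q (wk j (n j) w) x.
Proof.
pose F k (b : bool) := if k == j then wprob b (prior th (wk j (n j) w)) * dens1 b x
                       else wprob b (wk k (n k) w).
transitivity (\sum_(e : {ffun 'I_K -> bool}) \prod_(k < K) F k (e k)).
  apply: eq_bigr => e _; rewrite [RHS](bigD1 j)//= mulrC; congr (_ * _).
    by rewrite /F eqxx.
  by apply: eq_bigr => k kj; rewrite /F (negbTE kj).
rewrite -(bigA_distr_bigA F) (bigD1 j)//= [X in _ * X]big1 ?mulr1 => [|k kj].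
  by rewrite big_bool /F eqxx /obs_mix /mix /=.
by rewrite big_bool /F (negbTE kj) /= subrKC.
Qed.

Lemma measurable_state_dens n e j d' (T : measurableType d') (w : T -> Omega) (x : T -> Obs) :
  measurable_fun setT (fun h => others n e j (w h)) ->
  measurable_fun setT (fun h => wk j (n j) (w h)) -> measurable_fun setT x ->
  measurable_fun setT (fun h =>
    others n e j (w h) * (wprob (e j) (prior th (wk j (n j) (w h))) * dens1 (e j) (x h))).
Proof.
move=> mo mw mx; apply: measurable_funM => //; apply: measurable_funM.
  by apply: measurable_wprob; exact: measurable_prior.
by apply: measurableT_comp mx; exact: measurable_dens1.
Qed.

Lemma state_dens_ge0 n e j w x : 0 <=
  others n e j w * (wprob (e j) (prior th (wk j (n j) w)) * dens1 (e j) x).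
Proof. by rewrite !mulr_ge0 ?others_ge0 ?wprob_prior_ge0 ?dens1_ge0. Qed.

Lemma obs_marginal n j C (B0 : set Obs) : posterior_ok n -> <<s cyls n >> C ->
  measurable B0 ->
  P (C `&` X j (n j).+1 @^-1` B0) =
  (\int[P]_(w in C) \int[nu]_(x in B0) (obs_mix th p q (wk j (n j) w) x)%:E)%E.
Proof.
move=> nP nC mB0; have mC := sigma_cyls_measurable nC.
rewrite (measure_fin_partition P (s := st (incr n j))); last 2 first.
- by apply: measurableI => //; exact: measurable_preX.
- exact: measurable_st.
rewrite (eq_bigr _ (fun e _ => obs_state e j nP nC mB0)).
rewrite -ge0_integral_sum//; last 2 first.
- move=> e; apply: measurable_funTS.
  have := @measurable_fun_fubini_tonelli_F _ _ Omega Obs R nu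
    (fun z => (others n e j z.1 * (wprob (e j) (prior th (wk j (n j) z.1)) *
       dens1 (e j) z.2) * \1_B0 z.2)%:E).
  rewrite /fubini_F /= => H.
  rewrite (_ : (fun w => _) = (fun w => \int[nu]_x (others n e j w *
      (wprob (e j) (prior th (wk j (n j) w)) * dens1 (e j) x) * \1_B0 x)%:E)%E); last first.
    apply/funext => w; rewrite [LHS]integral_mkcond; apply: eq_integral => x _.
    by rewrite EFinM epatch_indic.
  apply: H => [|z]; last by rewrite lee_fin mulr_ge0 ?state_dens_ge0.
  apply/measurable_EFinP; apply: measurable_funM.
    apply: measurable_state_dens => //.
    - by apply: measurableT_comp; [exact: measurable_others|].
    - by apply: measurableT_comp; [exact: measurable_wk|].
  by apply: measurableT_comp => //; exact: measurable_indic.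
- by move=> e w _; apply: integral_ge0 => x _; rewrite lee_fin state_dens_ge0.
apply: eq_integral => w _.
rewrite -ge0_integral_sum//; last 2 first.
- move=> e; apply: measurable_funTS; apply/measurable_EFinP.
  exact: (@measurable_state_dens n e j _ Obs (fun=> w) id).
- by move=> e x _; rewrite lee_fin state_dens_ge0.
by apply: eq_integral => x _; rewrite sumEFin sum_states.
Qed.

Lemma obs_integral n j (F : hist n * Obs -> \bar R) : posterior_ok n ->
  measurable_fun setT F -> (forall z, 0 <= F z)%E ->
  (\int[P]_w F (w, X j (n j).+1 w) =
   \int[P]_w \int[nu]_x (F (w, x) * (obs_mix th p q (wk j (n j) w) x)%:E))%E.
Proof.
move=> nP mF F0.
pose M (z : hist n * Obs) := obs_mix th p q (wk j (n j) z.1) z.2.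
apply: (@integral_history _ _ _ _ _ P nu (cyls n) _ M) => //.
- exact: sigma_cyls_measurable.
- apply: measurable_obs_mix => //.
  by apply: measurableT_comp => //; exact: measurable_hist_wk.
- by move=> z; exact: obs_mix_ge0.
- by move=> C B0 nC mB0; exact: obs_marginal.
Qed.

Lemma wprob_obs_upd b w x : wprob b (obs_upd th p q w x) * obs_mix th p q w x =
  wprob b (prior th w) * dens1 b x.
Proof.
have c01 := prior01 th01 w.
by case: b => /=; rewrite /obs_upd /obs_mix ?bayesM ?bayesMC.
Qed.

(** Both sides are finite measures, compared on cylinders. There the new observation is integrated
    against its conditional density [obs_mix], which cancels the denominator of Bayes' rule and
    leaves the predicted state times its density. *)
Lemma posterior_incr n j : posterior_ok n -> posterior_ok (incr n j).
Proof.
move=> nP e C nC.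
have mC := sigma_cyls_measurable nC.
have mst := measurable_st (incr n j) e.
have -> : P (C `&` st (incr n j) @^-1` [set e]) = mrestr P mst C by [].
have -> : (\int[P]_(w in C) (joint (incr n j) e w)%:E)%E =
    densitym P (measurable_joint (incr n j) e) (joint_ge0 (incr n j) e) C by [].
apply: (measure_sigma_ext (G := cyls (incr n j))) => //.
- exact: cyls_setI.
- exact: cyls_setT.
- exact: cyls_measurable.
- by rewrite /= /mrestr -ge0_fin_numE// fin_num_measure//; exact: measurableI.
move=> _ [B [mB ->]]; rewrite densitymE /= /mrestr cyl_incrE.
set B0 := B j (n j).+1; have mB0 : measurable B0 by exact: mB.
have nB : <<s cyls n >> (cyl n B) by apply: sub_sigma_algebra; exists B.
have mcB : measurable (cyl n B) by exact: sigma_cyls_measurable nB.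
rewrite (obs_state _ _ nP)//.
pose F (z : hist n * Obs) := ((fun z : hist n * Obs =>
  (others n e j z.1 * wprob (e j) (obs_upd th p q (wk j (n j) z.1) z.2))%:E)
  \_ (cyl n B `*` B0)) z.
have F0 z : (0 <= F z)%E.
  rewrite /F patchE; case: ifP => // _; rewrite lee_fin mulr_ge0 ?others_ge0//.
  by apply: wprob_ge0; exact: obs_upd_itv.
have mF : measurable_fun setT F.
  apply/(measurable_restrictT _ _).1; first exact: measurableX.
  apply: measurable_funTS; apply/measurable_EFinP; apply: measurable_funM.
    by apply: measurableT_comp => //; exact: measurable_hist_others.
  apply: measurable_wprob; apply: measurable_obs_upd => //.
  by apply: measurableT_comp => //; exact: measurable_hist_wk.
transitivity (\int[P]_w F (w, X j (n j).+1 w))%E; last first.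
  rewrite [RHS]integral_mkcond; apply: eq_integral => w _; rewrite /F !patchE.
  rewrite in_setX /= in_setI.
  rewrite (_ : (w \in X j (n j).+1 @^-1` B0) = (X j (n j).+1 w \in B0)) /=; last first.
    by apply/idP/idP; rewrite !inE.
  case: ifP => // _; congr EFin; rewrite (joint_others _ _ j) mulrC.
  rewrite /incr eqxx addn1 /=; congr (_ * _).
  by apply: eq_bigr => k kj; rewrite /incr (negbTE kj) addn0.
rewrite (obs_integral _ nP mF F0) [LHS]integral_mkcond; apply: eq_integral => w _.
rewrite patchE; case: ifPn => wB; last first.
  by rewrite integral0_eq// => x _; rewrite /F patchE in_setX /= (negbTE wB) mul0e.
rewrite [LHS]integral_mkcond; apply: eq_integral => x _.
rewrite /F !patchE in_setX /= wB /=; case: ifP => _; last by rewrite mul0e.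
by rewrite -EFinM -mulrA wprob_obs_upd.
Qed.

(* All streams observed up to time [s], the first [i] ones once more. *)
Definition cnt s i : 'I_K -> nat := fun k => (s + (k < i))%N.

Lemma cnt0 s : cnt s 0 = fun=> s.
Proof. by apply/funext => k; rewrite /cnt addn0. Qed.

Lemma cntK s : cnt s K = fun=> s.+1.
Proof. by apply/funext => k; rewrite /cnt ltn_ord addn1. Qed.

Lemma cntS s j : cnt s j.+1 = incr (cnt s j) j.
Proof.
apply/funext => k; rewrite /cnt /incr -addnA ltnS leq_eqVlt.
by have [->|kj] := eqVneq k j; rewrite ?eqxx ?ltnn// (negbTE (kj : (k != j :> nat))) addn0.
Qed.

(** An inner induction adds the observations of one time stream by stream; an outer one advances
    time. *)
Lemma posterior_cnt s i : (i <= K)%N -> posterior_ok (cnt s i).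
Proof.
have H s' : posterior_ok (cnt s' 0) -> forall i, (i <= K)%N -> posterior_ok (cnt s' i).
  move=> s0; elim=> // i' IH iK; rewrite (cntS s' (Ordinal iK)).
  by apply: posterior_incr; exact/IH/ltnW.
suff s0 : posterior_ok (cnt s 0) by move: i; exact: H.
elim: s => [|s IH]; first by rewrite cnt0; exact: posterior0.
by rewrite cnt0 -cntK; exact: H.
Qed.

Lemma posterior_const s : posterior_ok (fun=> s).
Proof. by rewrite -cnt0; exact: posterior_cnt. Qed.

Lemma posterior_single s k C : <<s cyls (fun=> s) >> C ->
  P (C `&` [set w | cp_lt (tau k w) s]) = (\int[P]_(w in C) (wk k s w)%:E)%E.
Proof.
move=> sC; have mC := sigma_cyls_measurable sC.
rewrite (measure_fin_partition P (s := st (fun=> s))); last 2 first.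
- apply: measurableI => //.
  rewrite (_ : [set w | _] = \bigcup_(e in [set e : {ffun 'I_K -> bool} | e k])
    (st (fun=> s) @^-1` [set e])).
    apply: fin_bigcup_measurable; first exact: finite_finset.
    by move=> e _; exact: measurable_st.
  apply/seteqP; split => w /=.
    by move=> tw; exists (st (fun=> s) w) => //=; rewrite ffunE.
  by move=> [e /= ek ew]; move: ek; rewrite -ew ffunE.
- exact: measurable_st.
under eq_bigr => e _.
  rewrite (_ : _ `&` _ = if e k then C `&` st (fun=> s) @^-1` [set e] else set0); last first.
    apply/seteqP; split => w /=.
      by move=> [[Cw tw] sw]; rewrite -sw ffunE tw.
    case: ifP => // ek [Cw sw]; split => //; split => //.
    by move: ek; rewrite -sw ffunE.
  over.
rewrite /= (eq_bigr (fun e : {ffun 'I_K -> bool} =>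
  \int[P]_(w in C) ((e k)%:R * joint (fun=> s) e w)%:E)%E); last first.
  move=> e _; case: ifP => _; last first.
    by rewrite measure0 integral0_eq// => w _; rewrite mul0r.
  by apply: etrans (@posterior_const s e C sC) _; apply: eq_integral => w _; rewrite mul1r.
rewrite -ge0_integral_sum//; last 2 first.
- move=> e; apply: measurable_funTS; apply/measurable_EFinP; apply: measurable_funM => //.
  exact: measurable_joint.
- by move=> e w _; rewrite lee_fin mulr_ge0 ?joint_ge0.
apply: eq_integral => w _; rewrite sumEFin; congr EFin.
pose F i (b : bool) := (if i == k then b%:R else 1) * wprob b (wk i s w).
transitivity (\sum_(e : {ffun 'I_K -> bool}) \prod_(i < K) F i (e i)).
  apply: eq_bigr => e _; rewrite big_split /=; congr (_ * _).
  rewrite (bigD1 k)//= eqxx big1 ?mulr1// => i ik.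
  by rewrite (negbTE ik).
rewrite -(bigA_distr_bigA F) (bigD1 k)//= [X in _ * X]big1 ?mulr1 => [|i ik].
  by rewrite big_bool /F eqxx /= mul1r mul0r addr0.
by rewrite big_bool /F (negbTE ik) /= !mul1r subrKC.
Qed.

End Posterior.

(** * Procedures *)

Lemma cyls_mono d dO (Omega : measurableType d) (Obs : measurableType dO) (K : nat)
    (X : 'I_K -> nat -> Omega -> Obs) (n n' : 'I_K -> nat) :
  (forall k, (n k <= n' k)%N) -> <<s cyls X n >> `<=` <<s cyls X n' >>.
Proof.
move=> nn'; apply: sub_sigma_algebra2 => _ [B [mB ->]].
exists (fun k s => if (s <= n k)%N then B k s else setT); split.
  by move=> k s; case: ifP.
apply/seteqP; split => w /= wB k s /andP[s0 sn].
  by case: ifP => // sk; apply: wB; rewrite s0.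
by have := wB k s; rewrite s0 sn (leq_trans sn (nn' k)); exact.
Qed.

(** After pushing [P] forward to the smaller sigma-algebra, [f] and [g] have equal integrals over
    all measurable sets. The exceptional set found there is measurable and null for [P] too. *)
Lemma cond_exp_unique d (T : measurableType d) (R : realType)
    (P : {finite_measure set T -> \bar R}) (G : set (set T)) (f g : T -> R) :
  <<s G >> `<=` measurable ->
  measurable_fun setT (f : g_sigma_algebraType G -> R) ->
  measurable_fun setT (g : g_sigma_algebraType G -> R) ->
  P.-integrable setT (EFin \o f) ->
  (forall A, <<s G >> A -> \int[P]_(w in A) (f w)%:E = \int[P]_(w in A) (g w)%:E)%E ->
  {ae P, forall w, f w = g w}.
Proof.
move=> Gm mf mg fint fg; pose H := g_sigma_algebraType G.
have mid : measurable_fun setT (id : T -> g_sigma_algebraType G).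
  by move=> _ B mB; rewrite setTI; exact: Gm.
have fint' : (pushm P mid).-integrable setT (EFin \o f : g_sigma_algebraType G -> \bar R).
  by apply: (integrable_pushforward mid) => //; exact/measurable_EFinP.
have [N [mN N0 fgN]] : ae_eq (pushm P mid) setT
    (EFin \o f : g_sigma_algebraType G -> \bar R) (EFin \o g).
  have pE (D : set H) (h : H -> R) : measurable D -> measurable_fun setT h ->
      (\int[pushm P mid]_(w in D) (h w)%:E = \int[P]_(w in D) (h w)%:E)%E.
    move=> mD mh; rewrite [LHS]integralE [RHS]integralE.
    have mhE : measurable_fun setT (EFin \o h) by exact/measurable_EFinP.
    congr (_ - _)%E; rewrite (ge0_integral_pushforward mid)//.
    - by apply: measurable_funepos; exact: measurable_funTS.
    - by apply: measurable_funeneg; exact: measurable_funTS.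
  apply: integral_ae_eq => //; first exact/measurable_EFinP.
  by move=> D _ GD; rewrite !pE// fg.
exists N; split => //; first exact: Gm.
by apply: subset_trans fgN => w /= nfg fgw; apply: nfg; have [] := fgw I.
Qed.

(** * Integrands indexed by a random element of a finite type *)

Section FinitePartition.
Context d (T : measurableType d) (R : realType) (F : finType) (s : T -> F).
Hypothesis ms : forall a, measurable (s @^-1` [set a]).

Lemma fin_partitionE (h : F -> T -> R) w :
  h (s w) w = \sum_(a : F) (\1_(s @^-1` [set a]) w * h a w).
Proof.
rewrite (bigD1 (s w))//= big1 ?addr0 => [|a /eqP sa].
  by rewrite indicE mem_set//= mul1r.
by rewrite indicE memNset ?mul0r// => /esym.
Qed.

Lemma measurable_fin_partition (h : F -> T -> R) :
  (forall a, measurable_fun setT (h a)) -> measurable_fun setT (fun w => h (s w) w).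
Proof.
move=> mh; under eq_fun do rewrite fin_partitionE.
by apply: measurable_sum => a; apply: measurable_funM => //; exact: measurable_indic.
Qed.

Lemma integral_fin_partition (mu : {measure set T -> \bar R}) (D : set T)
    (h : F -> T -> R) :
  measurable D -> (forall a, measurable_fun setT (h a)) -> (forall a w, 0 <= h a w) ->
  (\int[mu]_(w in D) (h (s w) w)%:E =
   \sum_(a : F) \int[mu]_(w in D `&` s @^-1` [set a]) (h a w)%:E)%E.
Proof.
move=> mD mh h0.
under eq_integral do rewrite fin_partitionE -sumEFin.
rewrite ge0_integral_sum//.
- apply: eq_bigr => a _; rewrite [RHS]integral_mkcondr; apply: eq_integral => w _.
  by rewrite epatch_indic EFinM muleC.
- move=> a; apply: measurable_funTS; apply/measurable_EFinP.
  by apply: measurable_funM => //; exact: measurable_indic.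
- by move=> a w _; rewrite lee_fin mulr_ge0.
Qed.

End FinitePartition.

Section Procedures.
Context (R : realType) (d dO : measure_display) (Omega : measurableType d)
  (Obs : measurableType dO) (P : probability Omega R)
  (nu : {sigma_finite_measure set Obs -> \bar R}) (K : nat) (th : R) (p q : Obs -> R)
  (tau : 'I_K -> Omega -> option nat) (X : 'I_K -> nat -> Omega -> Obs) (alpha : R).
Hypothesis th01 : 0 < th < 1.
Hypotheses (mp : measurable_fun setT p) (mq : measurable_fun setT q).
Hypotheses (p0 : forall x, 0 <= p x) (q0 : forall x, 0 <= q x).
Hypotheses (p1 : (\int[nu]_x (p x)%:E = 1)%E) (q1 : (\int[nu]_x (q x)%:E = 1)%E).
Hypothesis mtau : forall k m, measurable [set w | tau k w = m].
Hypothesis mX : forall k t, measurable_fun setT (X k t).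
Hypothesis law : forall (n : nat) (m : 'I_K -> option nat) (B : 'I_K -> nat -> set Obs),
  (forall k s, measurable (B k s)) ->
  P [set w | (forall k, tau k w = m k) /\
             (forall k s, (0 < s <= n)%N -> B k s (X k s w))]
  = ((\prod_(k < K) (geom_pmf th (m k))%:E) *
     \prod_(k < K) \prod_(1 <= s < n.+1)
       \int[nu]_(x in B k s) (obs_dens p q (m k) s x)%:E)%E.

Local Notation pw := (wk th p q X).
Local Notation T := (stepT nu th p q).
Local Notation V := (value nu th p q alpha).
Local Notation sig t := (<<s cyls X (fun=> t) >>).

Definition wv (t : nat) (w : Omega) : 'I_K -> R := fun k => pw k t w.

Lemma transition_step n j c f C : posterior_ok P th p q tau X n ->
  bounded_mfun c f -> <<s cyls X n >> C ->
  (\int[P]_(w in C) (step nu th p q j f (fun k => pw k (n k) w))%:E =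
   \int[P]_(w in C) (f (fun k => pw k (incr n j k) w))%:E)%E.
Proof.
move=> nP fb nC; have [mf fc] := fb.
have f0 u : 0 <= f u by case/andP: (fc u).
pose H := g_sigma_algebraType (cyls X n).
pose F (z : H * Obs) := ((fun z : H * Obs =>
  (f (upd (fun k => pw k (n k) z.1) j (obs_upd th p q (pw j (n j) z.1) z.2)))%:E)
  \_ (C `*` setT)) z.
have F0 z : (0 <= F z)%E by rewrite /F patchE; case: ifP => // _; rewrite lee_fin.
have mpw k : measurable_fun setT (fun z : H * Obs => pw k (n k) z.1).
  by apply: measurableT_comp => //; exact: measurable_hist_wk.
have mF : measurable_fun setT F.
  apply/(measurable_restrictT _ _).1; first exact: measurableX.
  apply: measurable_funTS; apply/measurable_EFinP.
  by apply: mf; apply: measurable_upd => //; exact: measurable_obs_upd.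
transitivity (\int[P]_w F (w, X j (n j).+1 w))%E; last first.
  rewrite [RHS]integral_mkcond; apply: eq_integral => w _; rewrite /F !patchE.
  rewrite in_setX /= in_setT andbT; case: ifP => // _; congr (f _)%:E.
  apply/funext => k; rewrite /upd /incr; have [->|kj] := eqVneq k j.
    by rewrite addn1.
  by rewrite addn0.
rewrite (obs_integral _ _ _ _ _ _ _ mtau mX law j nP mF F0)//.
rewrite [LHS]integral_mkcond; apply: eq_integral => w _.
rewrite patchE; case: ifPn => wC; last first.
  by rewrite integral0_eq// => x _; rewrite /F patchE in_setX /= (negbTE wC) mul0e.
rewrite (stepE _ _ _ _ _ _ _ _ _ fb)//; apply: eq_integral => x _.
by rewrite /F patchE in_setX /= wC in_setT/= -EFinM.
Qed.

(** Markov property for all streams together. They are advanced in the order of the enumeration, and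
    [C] stays in every intermediate history because these only grow. *)
Lemma transition s c f C : bounded_mfun c f -> sig s C ->
  (\int[P]_(w in C) (T f (wv s w))%:E = \int[P]_(w in C) (f (wv s.+1 w))%:E)%E.
Proof.
move=> fb sC.
suff H i : (i <= K)%N -> (\int[P]_(w in C) (T f (wv s w))%:E =
    \int[P]_(w in C) (steps nu th p q (drop i (enum 'I_K)) f
                       (fun k => pw k (cnt s i k) w))%:E)%E.
  by rewrite (H K)// drop_oversize ?size_enum_ord// cntK.
elim: i => [|i IH] iK; first by rewrite drop0 cnt0.
rewrite IH; last exact: ltnW.
pose j := Ordinal iK.
have -> : drop i (enum 'I_K) = j :: drop i.+1 (enum 'I_K).
  rewrite (drop_nth j) ?size_enum_ord//; congr (_ :: _).
  exact: (nth_ord_enum j j).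
rewrite /= (@transition_step _ _ c).
- by rewrite (cntS s j).
- exact: (posterior_cnt _ _ _ _ _ _ _ mtau mX law (ltnW iK)).
- exact: bounded_steps.
- by apply: cyls_mono sC => k; rewrite /cnt leq_addr.
Qed.

(** * The filtration of a procedure inside the full history *)

Implicit Types (S : nat -> Omega -> {set 'I_K}).

(** Measurability of the index sets is assumed only up to [t], so that the lemma can serve while a
    procedure is still being constructed. *)
Lemma filt_sub S t : (forall w, S 1%N w = [set: 'I_K]%SET) ->
  (forall s A, (0 < s < t)%N -> filt X S s [set w | S s.+1 w = A]) ->
  filt X S t `<=` sig t.
Proof.
move=> S1; elim/ltn_ind: t => t IH Smeas.
pose H := g_sigma_algebraType (cyls X (fun=> t)).
have mS k s : (0 < s <= t)%N -> @measurable _ H [set w | k \in S s w].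
  case: s => // -[|s] /andP[_ st].
    by rewrite (_ : [set w | _] = setT)//; apply/seteqP; split => // w _ /=; rewrite S1 inE.
  have -> : [set w | k \in S s.+2 w] =
      \bigcup_(A in [set A : {set 'I_K} | k \in A]) [set w | S s.+2 w = A].
    by apply/seteqP; split => w /=; [move=> kS; exists (S s.+2 w)|case=> A /= kA ->].
  apply: fin_bigcup_measurable; first exact: finite_finset.
  move=> A _; apply: (@cyls_mono _ _ _ _ _ X (fun=> s.+1)); first by move=> _; exact: ltnW.
  apply: IH => //; last by apply: Smeas.
  by move=> s' A' /andP[s'0 s's]; apply: Smeas; rewrite s'0 (ltn_trans s's).
apply: smallest_sub; first exact: smallest_sigma_algebra.
move=> A [k [s [st [->|[B [mB ->]]]]]]; first exact: mS.
apply: (@measurableI _ H); first exact: mS.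
rewrite -[X in measurable X]setTI.
by apply: (@measurable_hist_X _ _ _ _ _ X (fun=> t) k s).
Qed.

Section OneProcedure.
Variable S : nat -> Omega -> {set 'I_K}.
Hypothesis procS : is_procedure X S.

Local Notation filtT t := (g_sigma_algebraType (gen_sets X S t)).

Lemma proc_filt_sub t : filt X S t `<=` sig t.
Proof.
by case: procS => S1 _ Sm; apply: filt_sub => // s A /andP[s0 _]; exact: Sm.
Qed.

Lemma proc_filt_measurable t : filt X S t `<=` measurable.
Proof. by apply: subset_trans (@proc_filt_sub t) _; exact: sigma_cyls_measurable. Qed.

Lemma filt_mem k s t : (0 < s <= t)%N -> filt X S t [set w | k \in S s w].
Proof. by move=> st; apply: sub_sigma_algebra; exists k, s; split => //; left. Qed.

Lemma filt_eq s t A : (0 < s <= t)%N -> filt X S t (S s @^-1` [set A]).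
Proof.
move=> st.
rewrite (_ : _ @^-1` _ = \bigcap_(k in [set: 'I_K]) [set w | (k \in S s w) = (k \in A)]).
  apply: (@fin_bigcap_measurable _ (filtT t)) => // k _.
  have mk := filt_mem k st; case: (k \in A) => //.
  rewrite (_ : [set w | _] = ~` [set w | k \in S s w]).
    exact: (@measurableC _ (filtT t)).
  by apply/seteqP; split => w /=; [move=> ->|move/negP/negbTE].
apply/seteqP; split => w /=; first by move=> SA k _ /=; rewrite SA.
by move=> Sw; apply/setP => k; exact: Sw.
Qed.

Lemma measurable_S s A : (0 < s)%N -> measurable (S s @^-1` [set A]).
Proof.
by move=> s0; apply: (@proc_filt_measurable s); apply: filt_eq; rewrite s0 leqnn.
Qed.

Lemma measurable_filt_X k s t : (0 < s <= t)%N -> measurable_fun setT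
  ((fun w => if k \in S s w then X k s w else point) : filtT t -> Obs).
Proof.
move=> st _ B mB; rewrite setTI.
have -> : (fun w => if k \in S s w then X k s w else point) @^-1` B =
    [set w | k \in S s w /\ B (X k s w)] `|`
    ([set w | ~~ (k \in S s w)] `&` [set w | B point]).
  apply/seteqP; split => w /=; first by case: ifP => kS Bw; [left|right].
  by case=> -[kS Bw]; rewrite ?kS ?(negbTE kS).
apply: (@measurableU _ (filtT t)).
  by apply: sub_sigma_algebra; exists k, s; split => //; right; exists B.
apply: (@measurableI _ (filtT t)).
  rewrite (_ : [set w | _] = ~` [set w | k \in S s w]).
    by apply: (@measurableC _ (filtT t)); exact: filt_mem.
  by apply/seteqP; split => w /= /negP.
have [Bp|Bp] := pselect (B point).
  by rewrite (_ : [set w | _] = setT)//; apply/seteqP; split.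
by rewrite (_ : [set w | _] = set0)//; apply/seteqP; split.
Qed.

Lemma filt_le s t : (s <= t)%N -> filt X S s `<=` filt X S t.
Proof.
move=> st; apply: sub_sigma_algebra2 => A [k [i [/andP[i0 its] H]]].
by exists k, i; split => //; rewrite i0 (leq_trans its).
Qed.

Definition active k t w : R := if k \in S t w then pw k t w else 0.

(** Index sets decrease, so a stream active at [t] has been observed at all earlier times, and its
    filter uses only data in the procedure's filtration. The mask hides the weights of dropped
    streams. *)
Lemma measurable_active k t : (0 < t)%N ->
  measurable_fun setT (active k t : filtT t -> R).
Proof.
case: procS => S1 Ss _; case: t => // t _; rewrite /active.
elim: t => [|t IH].
  rewrite (_ : (fun w => _) = fun w => if k \in S 1%N w then obs_upd th p q 0
      (if k \in S 1%N w then X k 1%N w else point) else 0); last first.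
    by apply/funext => w; case: ifP.
  apply: measurable_fun_ifT => //.
    apply: (measurable_fun_bool true); rewrite setTI; exact: filt_mem.
  by apply: measurable_obs_upd => //; exact: measurable_filt_X.
rewrite (_ : (fun w => _) = fun w => if k \in S t.+2 w then
    obs_upd th p q (if k \in S t.+1 w then pw k t.+1 w else 0)
      (if k \in S t.+2 w then X k t.+2 w else point) else 0); last first.
  apply/funext => w; case: ifP => // kS.
  by have /fintype.subsetP/(_ _ kS) -> := Ss t.+1 w isT.
apply: measurable_fun_ifT => //.
  by apply: (measurable_fun_bool true); rewrite setTI; apply: filt_mem; rewrite leqnn.
apply: measurable_obs_upd => //; last by apply: measurable_filt_X; rewrite leqnn.
by move=> _ B mB; apply: (@filt_le t.+1) => //; exact: IH.
Qed.

Definition phi s n : \bar R := (\int[P]_w (V n (S s w) (wv s w))%:E)%E.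

Let V_good n : good (fun A : {set 'I_K} => V n A).
Proof. exact: good_value. Qed.

Let V_measurable n (A : {set 'I_K}) s : measurable_fun setT (fun w => V n A (wv s w)).
Proof.
by case: (V_good n) => /(_ A)[mV _] _ _ _; apply: mV => k; exact: measurable_wk.
Qed.

Let TV_measurable n (A : {set 'I_K}) s : measurable_fun setT (fun w => T (V n A) (wv s w)).
Proof.
case: (good_stepT th01 mp mq p0 q0 p1 q1 (V_good n)) => /(_ A)[mV _] _ _ _.
by apply: mV => k; exact: measurable_wk.
Qed.

Let TV_ge0 n (A : {set 'I_K}) w : 0 <= T (V n A) w.
Proof.
by case: (good_stepT th01 mp mq p0 q0 p1 q1 (V_good n)) => /(_ A)[_ /(_ w)/andP[]].
Qed.

(** [S s.+1] is already known at time [s]: on each event where it equals a fixed [A], the Markov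
    property applies to the fixed function [V n A]. *)
Lemma phi_step s n : (0 < s)%N ->
  phi s.+1 n = (\int[P]_w (T (V n (S s.+1 w)) (wv s w))%:E)%E.
Proof.
move=> s0; have mS := @measurable_S s.+1 ^~ isT.
rewrite /phi (@integral_fin_partition _ _ _ _ _ mS P setT
  (fun A w => V n A (wv s.+1 w)))//; last by move=> *; exact: value_ge0.
rewrite (@integral_fin_partition _ _ _ _ _ mS P setT (fun A w => T (V n A) (wv s w)))//.
apply: eq_bigr => A _; rewrite setTI; apply/esym.
apply: (@transition _ #|'I_K|%:R).
  by case: (V_good n) => /(_ A).
by apply: proc_filt_sub; case: procS => _ _; exact.
Qed.

Lemma le_phi_step s n : (0 < s)%N ->
  {ae P, forall w, admissible alpha (S s.+1 w) (wv s w)} ->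
  (phi s.+1 n <= phi s n.+1)%E.
Proof.
move=> s0 adm; rewrite phi_step//; case: procS => _ Ss _.
apply: ae_ge0_le_integral => //.
- by move=> w _; rewrite lee_fin.
- apply/measurable_EFinP; apply: (measurable_fin_partition (s := S s.+1)
    (fun A => @measurable_S s.+1 A isT) (h := fun A w => T (V n A) (wv s w))).
  by [].
- by move=> w _; rewrite lee_fin value_ge0.
- apply/measurable_EFinP; apply: (measurable_fin_partition (s := S s)
    (fun A => @measurable_S s A s0) (h := fun A w => V n.+1 A (wv s w))).
  by [].
- by apply: filterS adm => w aw _; rewrite lee_fin le_value// Ss.
Qed.

Lemma phi_step_greedy s n : (0 < s)%N ->
  {ae P, forall w, greedy alpha (S s w) (wv s w) (S s.+1 w)} ->
  phi s.+1 n = phi s n.+1.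
Proof.
move=> s0 gr; rewrite phi_step//; case: procS => _ Ss _.
apply: ge0_ae_eq_integral => //.
- apply/measurable_EFinP; apply: (measurable_fin_partition (s := S s.+1)
    (fun A => @measurable_S s.+1 A isT) (h := fun A w => T (V n A) (wv s w))).
  by [].
- apply/measurable_EFinP; apply: (measurable_fin_partition (s := S s)
    (fun A => @measurable_S s A s0) (h := fun A w => V n.+1 A (wv s w))).
  by [].
- by move=> w _; rewrite lee_fin.
- by move=> w _; rewrite lee_fin value_ge0.
- by apply: filterS gr => w gw _; rewrite (value_greedy _ _ _ _ _ _ _ _ gw).
Qed.

(** An explicit version of LFNR at time [t.+1]: change indicators are replaced by weights. Only
    streams active at [t] occur, which makes it measurable for the procedure's filtration. *)
Definition lfnr t w : R := (\sum_(k in S t.+1 w) pw k t w) / (maxn #|S t.+1 w| 1)%:R.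

Let lfnr_den_gt0 t w : 0 < (maxn #|S t.+1 w| 1)%:R :> R.
Proof. by rewrite ltr0n leq_max orbT. Qed.

Lemma lfnr_le t w :
  (lfnr t w <= alpha) = (\sum_(k in S t.+1 w) pw k t w <= alpha * (maxn #|S t.+1 w| 1)%:R).
Proof. by rewrite ler_pdivrMr. Qed.

Lemma lfnr_admissible t w : lfnr t w <= alpha -> admissible alpha (S t.+1 w) (wv t w).
Proof.
rewrite lfnr_le /admissible; case: (posnP #|S t.+1 w|) => [S0 _|S0].
  rewrite S0 mulr0 big1// => k; move/eqP: S0; rewrite cards_eq0 => /eqP ->.
  by rewrite inE.
by rewrite (maxn_idPl S0).
Qed.

Lemma admissible_lfnr t w : 0 <= alpha -> admissible alpha (S t.+1 w) (wv t w) ->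
  lfnr t w <= alpha.
Proof.
move=> a0 aS; rewrite lfnr_le; apply: le_trans aS _.
by rewrite ler_wpM2l// ler_nat leq_maxl.
Qed.

Lemma lfnr_itv t w : 0 <= lfnr t w <= 1.
Proof.
have w01 k : 0 <= pw k t w <= 1 by exact: wk_itv.
rewrite /lfnr divr_ge0//=; last by apply: sumr_ge0 => k _; case/andP: (w01 k).
rewrite ler_pdivrMr// mul1r (@le_trans _ _ #|S t.+1 w|%:R)//; last by rewrite ler_nat leq_maxl.
by rewrite -sum1_card natr_sum; apply: ler_sum => k _; case/andP: (w01 k).
Qed.

Lemma measurable_lfnr t : (0 < t)%N -> measurable_fun setT (lfnr t : filtT t -> R).
Proof.
move=> t0; case: procS => _ Ss Sm.
have -> : lfnr t = (fun w => (\sum_(k in S t.+1 w) active k t w) / (maxn #|S t.+1 w| 1)%:R).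
  apply/funext => w; rewrite /lfnr; congr (_ / _); apply: eq_bigr => k kS.
  by rewrite /active (fintype.subsetP (Ss t w t0) _ kS).
apply: (@measurable_fin_partition _ (filtT t) _ _ (S t.+1) (fun A => Sm t A t0)
  (fun A w => (\sum_(k in A) active k t w) / (maxn #|A| 1)%:R)) => A.
apply: measurable_funM => //.
under eq_fun do rewrite -big_enum.
by apply: measurable_sum => k; exact: measurable_active.
Qed.

Lemma changed_indic t k w : (cp_lt (tau k w) t)%:R = \1_[set w | cp_lt (tau k w) t] w :> R.
Proof. by rewrite indicE; congr (nat_of_bool _)%:R; apply/idP/idP; rewrite inE. Qed.

(** The weight is a posterior given the full history, so its integral is right on the events of the
    smaller filtration as well. *)
Lemma integral_changed t k E : filt X S t E ->
  (\int[P]_(w in E) ((cp_lt (tau k w) t)%:R)%:E = \int[P]_(w in E) (pw k t w)%:E)%E.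
Proof.
move=> tE; have mE := proc_filt_measurable tE; have mC := measurable_changed mtau t k.
apply: etrans (posterior_single th01 mp mq p0 q0 p1 q1 mtau mX law k (proc_filt_sub tE)).
under eq_integral do rewrite changed_indic.
by rewrite (integral_indic P mE mC) setIC.
Qed.

Lemma integral_lfnr t E : (0 < t)%N -> filt X S t E ->
  (\int[P]_(w in E) (FNP R tau S t w)%:E = \int[P]_(w in E) (lfnr t w)%:E)%E.
Proof.
move=> t0 tE; have mE := proc_filt_measurable tE; case: procS => _ _ Sm.
have mS := @measurable_S t.+1 ^~ isT.
pose h (f : 'I_K -> Omega -> R) (A : {set 'I_K}) w :=
  (\sum_(k in A) f k w) / (maxn #|A| 1)%:R.
(* Expanding over the values of [S t.+1] treats indicators and weights alike; each resulting event
   lies in the filtration, where their integrals agree. *)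
have H (f : 'I_K -> Omega -> R) : (forall k, measurable_fun setT (f k)) ->
    (forall k w, 0 <= f k w) -> (\int[P]_(w in E) (h f (S t.+1 w) w)%:E =
    \sum_(A : {set 'I_K}) \sum_(k in A) ((maxn #|A| 1)%:R^-1)%:E *
      \int[P]_(w in E `&` S t.+1 @^-1` [set A]) (f k w)%:E)%E.
  move=> mf f0; rewrite (@integral_fin_partition _ _ _ _ _ mS P E)//.
  - apply: eq_bigr => A _.
    have mEA : measurable (E `&` S t.+1 @^-1` [set A]) by exact: measurableI.
    transitivity (\int[P]_(w in E `&` S t.+1 @^-1` [set A])
        (\sum_(k <- enum A) (((maxn #|A| 1)%:R^-1)%:E * (f k w)%:E))%E)%E.
      apply: eq_integral => w _; rewrite /h mulr_suml -sumEFin big_enum.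
      by apply: eq_bigr => k _; rewrite -EFinM mulrC.
    rewrite ge0_integral_sum//.
    + rewrite big_enum; apply: eq_bigr => k _; rewrite ge0_integralZl//.
      * by apply: measurable_funTS; exact/measurable_EFinP.
      * by move=> w _; rewrite lee_fin.
    + by move=> k; apply: measurable_funTS; apply: measurable_funeM; exact/measurable_EFinP.
    + by move=> k w _; rewrite -EFinM lee_fin mulr_ge0.
  - move=> A; apply: measurable_funM => //; under eq_fun do rewrite -big_enum.
    exact: measurable_sum.
  - by move=> A w; rewrite /h divr_ge0//; exact: sumr_ge0.
rewrite [LHS](H (fun k w => (cp_lt (tau k w) t)%:R)).
- rewrite [RHS](H (fun k w => pw k t w)).
  + apply: eq_bigr => A _; apply: eq_bigr => k _; congr (_ * _)%E.
    apply: integral_changed; apply: (@measurableI _ (filtT t)) => //.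
    exact: Sm.
  + by move=> k; exact: measurable_wk.
  + by move=> k w; case/andP: (wk_itv X th01 p0 q0 k t w).
- move=> k; under eq_fun do rewrite changed_indic.
  by apply: measurable_indic; exact: measurable_changed mtau t k.
- by [].
Qed.

Lemma measurable_of_filt t (f : Omega -> R) :
  measurable_fun setT (f : filtT t -> R) -> measurable_fun setT f.
Proof. by apply: measurable_fun_subsigma; exact: proc_filt_measurable. Qed.

Lemma integrable_itv (f : Omega -> R) : measurable_fun setT f ->
  (forall w, 0 <= f w <= 1) -> P.-integrable setT (EFin \o f).
Proof.
move=> mf f01; apply: (@le_integrable _ _ _ _ _ measurableT _ (cst 1%E)).
- exact/measurable_EFinP.
- by move=> w _ /=; case/andP: (f01 w) => f0 f1; rewrite ger0_norm// normr1 lee_fin.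
- exact: finite_measure_integrable_cst.
Qed.

Lemma cond_exp_lfnr t : (0 < t)%N ->
  cond_exp_version P (filt X S t) (FNP R tau S t) (lfnr t).
Proof.
move=> t0; have ml := measurable_lfnr t0; split.
- by move=> B mB; have := ml measurableT B mB; rewrite setTI.
- by apply: integrable_itv; [exact: measurable_of_filt ml|exact: lfnr_itv].
- by move=> A tA; rewrite integral_lfnr.
Qed.

Lemma sub_meas_measurable t (f : Omega -> R) : sub_meas (filt X S t) f ->
  measurable_fun setT (f : filtT t -> R).
Proof. by move=> mf _ B mB; rewrite setTI; exact: mf. Qed.

Lemma T_alpha_admissible t : in_T_alpha P tau X alpha S -> (0 < t)%N ->
  {ae P, forall w, admissible alpha (S t.+1 w) (wv t w)}.
Proof.
move=> [_ Sa] t0; have [g [[mg ig gE] ga]] := Sa _ t0.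
have gl : {ae P, forall w, g w = lfnr t w}.
  apply: (@cond_exp_unique _ _ _ P (gen_sets X S t)) => //.
  - exact: proc_filt_measurable.
  - exact: sub_meas_measurable.
  - exact: measurable_lfnr.
  - by move=> A tA; rewrite gE// integral_lfnr.
by apply: filterS2 gl ga => w gw ga; apply: lfnr_admissible; rewrite -gw.
Qed.

(** The rule is run with arbitrary versions of posteriors given its own filtration. These agree
    almost surely with the weights on active streams only, hence the masked comparison; the greedy
    conditions look at no other streams. *)
Lemma T_star_greedy t : 0 <= alpha -> is_Tstar P tau X alpha S -> (0 < t)%N ->
  {ae P, forall w, greedy alpha (S t w) (wv t w) (S t.+1 w)}.
Proof.
move=> a0 [_ St] t0; have [W [WP WS]] := St _ t0.
have Wpw k : {ae P, forall w, (if k \in S t w then W k w else 0) = active k t w}.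
  have [mW iW WE] := WP k.
  have mk : filt X S t [set w | k \in S t w] by apply: filt_mem; rewrite t0 leqnn.
  have mWk : measurable_fun setT ((fun w => if k \in S t w then W k w else 0) : filtT t -> R).
    apply: measurable_fun_ifT => //; last exact: sub_meas_measurable.
    by apply: (measurable_fun_bool true); rewrite setTI.
  have patchk (f : Omega -> R) : (fun w => (if k \in S t w then f w else 0)%:E) =
      (fun w => (f w)%:E) \_ [set w | k \in S t w].
    apply/funext => w; rewrite patchE.
    by rewrite (_ : (w \in _) = (k \in S t w)); [case: ifP|apply/idP/idP; rewrite inE].
  apply: (@cond_exp_unique _ _ _ P (gen_sets X S t)) => //.
  - exact: proc_filt_measurable.
  - exact: measurable_active.
  - apply: (@le_integrable _ _ _ _ _ measurableT _ (fun w => (W k w)%:E)) => //.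
      by apply/measurable_EFinP; exact: measurable_of_filt mWk.
    by move=> w _ /=; case: ifP => // _; rewrite normr0 lee_fin.
  - move=> A tA; rewrite /active !patchk -!integral_mkcondr WE ?integral_changed//.
    + exact: (@measurableI _ (filtT t)).
    + exact: (@measurableI _ (filtT t)).
have /(filter_forall _) Wall := Wpw.
apply: filterS Wall => w Ww.
have [GS aG Gmin Gmax] := update_rule_greedy (S t w) (W ^~ w) a0.
rewrite WS.
have E k : k \in S t w -> wv t w k = W k w.
  by move=> kS; have := Ww k; rewrite /active kS.
have sumE (C : {set 'I_K}) : C \subset S t w -> \sum_(k in C) wv t w k = \sum_(k in C) W k w.
  by move=> CS; apply: eq_bigr => k kC; rewrite E// (fintype.subsetP CS).
split => //.
- by rewrite /admissible sumE.
- move=> i j iG jG; have /setDP[jS _] := jG.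
  by rewrite (E i (fintype.subsetP GS _ iG)) (E j jS); exact: Gmin iG jG.
- by move=> C CS; rewrite /admissible sumE//; exact: Gmax.
Qed.

Lemma T_star_in_T_alpha : 0 <= alpha -> is_Tstar P tau X alpha S ->
  in_T_alpha P tau X alpha S.
Proof.
move=> a0 Sstar; split => // t t0; exists (lfnr t); split; first exact: cond_exp_lfnr.
apply: filterS (T_star_greedy a0 Sstar t0) => w [_ aG _ _].
exact: admissible_lfnr.
Qed.

Lemma integral_util t : (\int[P]_w (util R S t w)%:E = \sum_(1 <= s < t.+1) phi s 0)%E.
Proof.
rewrite /util big_add1 /=; under eq_integral do rewrite big_add1 natr_sum -sumEFin /=.
rewrite ge0_integral_sum//.
move=> s; apply/measurable_EFinP.
by apply: (measurable_fin_partition (fun A => @measurable_S s.+1 A isT)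
  (h := fun A _ => #|A|%:R)).
Qed.

End OneProcedure.

End Procedures.

(** * Existence of the greedy procedure *)

(** The version is the Radon-Nikodym derivative of [P] restricted to [E] with respect to [P], both
    taken on the smaller sigma-algebra. *)
Lemma cond_exp_indic_exists d (T : measurableType d) (R : realType)
    (P : probability T R) (G : set (set T)) (E : set T) :
  <<s G >> `<=` measurable -> measurable E ->
  exists W : T -> R, cond_exp_version P <<s G >> (\1_E) W.
Proof.
move=> Gm mE; pose H := g_sigma_algebraType G.
have mid : measurable_fun setT (id : T -> H).
  by move=> _ B mB; rewrite setTI; exact: Gm.
have fin1 : fin_num_fun (pushm P mid).
  by move=> A mA; rewrite /= /pushforward fin_num_measure//; exact: Gm.
have fin2 : fin_num_fun (pushm (mrestr P mE) mid).
  move=> A mA; rewrite /= /pushforward /mrestr fin_num_measure//.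
  by apply: measurableI => //; exact: Gm.
pose mu1 := finm fin1; pose mu2 := finm fin2.
have dom : charge_of_finite_measure mu2 `<< mu1.
  apply/null_content_dominatesP => A mA A0; apply/eqP; rewrite eq_le.
  rewrite measure_ge0 andbT -A0; apply: le_measure => //; rewrite inE.
    by apply: measurableI => //; exact: Gm.
  exact: Gm.
pose f := Radon_Nikodym (charge_of_finite_measure mu2) mu1.
have ffin x : f x \is a fin_num by exact: Radon_Nikodym_fin_num.
have fint : mu1.-integrable setT f by exact: Radon_Nikodym_integrable.
have mf : measurable_fun setT f by exact: measurable_int fint.
pose W (x : T) := fine (f x).
have WE : EFin \o W = f by apply/funext => x; rewrite /= fineK.
have iW : P.-integrable setT (EFin \o W).
  rewrite WE; apply/integrableP; split.
    by apply: measurableT_comp mf mid.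
  have [_] := integrableP _ _ _ fint.
  rewrite (ge0_integral_pushforward mid)//.
  exact: measurableT_comp.
exists W; split => //.
- move=> B mB; have := measurableT_comp (@fine_measurable R _ measurableT) mf.
  by move=> /(_ measurableT B mB); rewrite setTI.
- move=> A GA; have mA := Gm _ GA.
  rewrite (integral_indic P mA mE) setIC.
  apply: etrans (esym (Radon_Nikodym_integral dom GA)); rewrite -/f.
  rewrite [RHS](integral_pushforward mid)//.
  + by apply: eq_integral => w _; rewrite /= fineK.
  + by rewrite -WE; exact: integrableS iW.
Qed.

Lemma measurable_fiber_ffun d (T : measurableType d) (J : finType)
    (b : T -> {ffun J -> bool}) :
  (forall j, measurable_fun setT (fun w => b w j)) ->
  forall b0, measurable (b @^-1` [set b0]).
Proof.
move=> mb b0.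
rewrite (_ : _ @^-1` _ = \bigcap_(j in [set: J]) ((fun w => b w j) @^-1` [set b0 j])).
  apply: fin_bigcap_measurable => // j _; rewrite -[X in measurable X]setTI.
  exact: mb.
apply/seteqP; split => w /=; first by move=> bw j _ /=; rewrite bw.
by move=> bw; apply/ffunP => j; exact: bw.
Qed.

Lemma measurable_fiber_comp d (T : measurableType d) (F : finType) (E : Type)
    (b : T -> F) (g : F -> E) :
  (forall a, measurable (b @^-1` [set a])) ->
  forall y, measurable [set w | g (b w) = y].
Proof.
move=> mb y.
rewrite (_ : [set w | _] = \bigcup_(a in [set a | g a = y]) (b @^-1` [set a])).
  by apply: fin_bigcup_measurable => //; exact: finite_finset.
by apply/seteqP; split => w /=; [exists (b w)|case=> a /= + ->].
Qed.

Lemma measurable_update_rule d (T : measurableType d) (R : realType) K (alpha : R)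
    (St : T -> {set 'I_K}) (W : 'I_K -> T -> R) : 0 <= alpha ->
  (forall A, measurable (St @^-1` [set A])) ->
  (forall k, measurable_fun setT (W k)) ->
  forall A, measurable [set w | update_rule alpha (St w) (W ^~ w) = A].
Proof.
move=> alpha0 mSt mW.
(* The rule depends on the weights only through finitely many comparisons. *)
pose o w : {ffun 'I_K * 'I_K -> bool} := [ffun ij =>
  (W ij.1 w < W ij.2 w) || ((W ij.1 w == W ij.2 w) && (ij.1 <= ij.2)%N)].
pose a w : {ffun {set 'I_K} -> bool} := [ffun C : {set 'I_K} =>
  \sum_(k in C) W k w <= alpha * #|C|%:R].
pose rule (x : {set 'I_K} * {ffun 'I_K * 'I_K -> bool} * {ffun {set 'I_K} -> bool}) :=
  let l := sort (fun i j => x.1.2 (i, j)) (enum x.1.1) in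
  let n := (\max_(n < (size l).+1 | x.2 [set k in take n l]%SET) (n : nat))%N in
  [set k in take n l]%SET.
pose b w := (St w, o w, a w).
have ruleE w : update_rule alpha (St w) (W ^~ w) = rule (b w).
  rewrite /update_rule /rule /=.
  rewrite (_ : (fun i j => o w (i, j)) = (fun i j : 'I_K =>
      (W i w < W j w) || ((W i w == W j w) && (i <= j)%N))); last first.
    by apply/funext => i; apply/funext => j; rewrite ffunE.
  set l := sort _ _.
  set n1 := (\max_(n < (size l).+1 | _) n)%N.
  set n2 := (\max_(n < (size l).+1 | _) n)%N.
  suff -> : n1 = n2 by [].
  apply: eq_bigl => n; rewrite ffunE.
  by rewrite average_le_admissible// ?sort_uniq ?enum_uniq// -ltnS.
have mb x : measurable (b @^-1` [set x]).
  case: x => [[x1 x2] x3].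
  rewrite (_ : _ @^-1` _ = St @^-1` [set x1] `&` o @^-1` [set x2] `&` a @^-1` [set x3]).
    apply: measurableI; first apply: measurableI => //.
      apply: measurable_fiber_ffun => ij; under eq_fun do rewrite ffunE.
      apply: measurable_or; first exact: measurable_fun_ltr.
      by apply: measurable_and => //; exact: measurable_fun_eqr.
    apply: measurable_fiber_ffun => C; under eq_fun do rewrite ffunE -big_enum.
    by apply: measurable_fun_ler => //; exact: measurable_sum.
  by apply/seteqP; split => w /=; [case=> ? ? ?|case=> -[? ?] ?; congr (_, _, _)].
move=> A; rewrite (_ : [set w | _] = [set w | rule (b w) = A]).
  exact: measurable_fiber_comp.
by apply/seteqP; split => w /=; rewrite ruleE.
Qed.

Lemma gen_sets_eq d dO (Omega : measurableType d) (Obs : measurableType dO) (K : nat)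
    (X : 'I_K -> nat -> Omega -> Obs) (S S' : nat -> Omega -> {set 'I_K}) t :
  (forall s, (0 < s <= t)%N -> S s = S' s) -> gen_sets X S t = gen_sets X S' t.
Proof.
move=> SS'; apply/seteqP; split => A [k [s [st H]]]; exists k, s; split => //.
  by rewrite -SS'.
by rewrite SS'.
Qed.

Section Existence.
Context (R : realType) (d dO : measure_display) (Omega : measurableType d)
  (Obs : measurableType dO) (P : probability Omega R) (K : nat)
  (tau : 'I_K -> Omega -> option nat) (X : 'I_K -> nat -> Omega -> Obs) (alpha : R).
Hypothesis alpha0 : 0 <= alpha.
Hypothesis mtau : forall k m, measurable [set w | tau k w = m].
Hypothesis mX : forall k t, measurable_fun setT (X k t).

Implicit Types (S : nat -> Omega -> {set 'I_K}).

Let changed k t : Omega -> R := fun w => (cp_lt (tau k w) t)%:R.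

(* Junk value [0] when the filtration of [S] is not made of measurable sets. *)
Definition post_version S t k : Omega -> R :=
  if pselect (exists W, cond_exp_version P (filt X S t) (changed k t) W) is left h
  then sval (cid h) else fun=> 0.

Lemma post_versionP S t k : filt X S t `<=` measurable ->
  cond_exp_version P (filt X S t) (changed k t) (post_version S t k).
Proof.
move=> Sm; rewrite /post_version; case: pselect => [h|]; first by case: cid.
have := cond_exp_indic_exists P Sm (measurable_changed mtau t k).
suff -> : \1_[set w | cp_lt (tau k w) t] = changed k t by [].
by apply/funext => w; rewrite /changed changed_indic.
Qed.

(* [stage t] is final at the times [s <= t.+1]. *)
Fixpoint stage t : nat -> Omega -> {set 'I_K} :=
  if t is t'.+1 then
    fun s w => if (s <= t'.+1)%N then stage t' s w
      else update_rule alpha (stage t' t'.+1 w)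
             (fun k => post_version (stage t') t'.+1 k w)
  else fun _ _ => [set: 'I_K]%SET.

(** An update depends on the filtration generated by the whole past of the procedure, so the
    recursion produces entire processes, of which this is the diagonal. *)
Definition Tstar s : Omega -> {set 'I_K} := stage s s.

Lemma stageE t s : (s <= t.+1)%N -> stage t s = Tstar s.
Proof.
elim: t s => [|t IH] s; first by case: s => [|[]].
rewrite leq_eqVlt => /orP[/eqP ->|]; last first.
  by rewrite ltnS => st; rewrite -IH//; apply/funext => w /=; rewrite st.
by apply/funext => w; rewrite /Tstar /= leqnn.
Qed.

Lemma Tstar1 w : Tstar 1 w = [set: 'I_K]%SET.
Proof. by []. Qed.

Lemma TstarS t w : (0 < t)%N -> Tstar t.+1 w =
  update_rule alpha (Tstar t w) (fun k => post_version Tstar t k w).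
Proof.
case: t => // t _; rewrite -(@stageE t.+1 t.+2)//= ltnn.
congr update_rule; first by rewrite stageE.
(* The chosen version depends on the procedure only through its filtration, and the two filtrations
   up to this time are the same family of sets. *)
apply/funext => k; rewrite /post_version /filt.
by rewrite (@gen_sets_eq _ _ _ _ _ X (stage t) Tstar)// => s /andP[_ st]; exact: stageE.
Qed.

(** Strong induction: measurability at earlier times makes the filtration at [t] consist of
    measurable sets, so the chosen posteriors are genuine versions and the next index set is
    measurable for it. *)
Lemma Tstar_filt t A : (0 < t)%N -> filt X Tstar t [set w | Tstar t.+1 w = A].
Proof.
elim/ltn_ind: t A => t IH A t0.
have Sm : filt X Tstar t `<=` measurable.
  apply: (@subset_trans _ <<s cyls X (fun=> t) >>); last exact: sigma_cyls_measurable.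
  apply: filt_sub => [w|s B /andP[s0 st]]; [exact: Tstar1|exact: IH].
pose H := g_sigma_algebraType (gen_sets X Tstar t).
have := @measurable_update_rule _ H R K alpha (Tstar t) (post_version Tstar t) alpha0.
rewrite (_ : [set w | Tstar t.+1 w = A] =
  [set w | update_rule alpha (Tstar t w) (fun k => post_version Tstar t k w) = A]).
  apply.
    by move=> B; apply: filt_eq; rewrite t0 leqnn.
  by move=> k _ B mB; rewrite setTI; have [+ _ _] := post_versionP k Sm; exact.
by apply/seteqP; split => w /=; rewrite TstarS.
Qed.

Lemma is_procedure_Tstar : is_procedure X Tstar.
Proof.
split => // [t w t0|t A t0]; last exact: Tstar_filt.
by rewrite TstarS//; case: (update_rule_greedy (Tstar t w) (post_version Tstar t ^~ w) alpha0).
Qed.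

Lemma is_Tstar_Tstar : is_Tstar P tau X alpha Tstar.
Proof.
split; first exact: is_procedure_Tstar.
move=> t t0; exists (post_version Tstar t); split => [k|w]; last exact: TstarS.
by apply: post_versionP; apply: proc_filt_measurable => //; exact: is_procedure_Tstar.
Qed.

End Existence.

(** * Optimality at all horizons *)

Lemma phi_first (R : realType) d dO (Omega : measurableType d) (Obs : measurableType dO)
    (P : probability Omega R) (nu : {sigma_finite_measure set Obs -> \bar R}) K th p q
    (X : 'I_K -> nat -> Omega -> Obs) alpha S S' n :
  is_procedure X S -> is_procedure X S' ->
  phi P nu th p q X alpha S 1 n = phi P nu th p q X alpha S' 1 n.
Proof. by move=> [S1 _ _] [S'1 _ _]; apply: eq_integral => w _; rewrite S1 S'1. Qed.

Section Optimality.
Context (R : realType) (d dO : measure_display) (Omega : measurableType d)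
  (Obs : measurableType dO) (P : probability Omega R)
  (nu : {sigma_finite_measure set Obs -> \bar R}) (K : nat) (th : R) (p q : Obs -> R)
  (tau : 'I_K -> Omega -> option nat) (X : 'I_K -> nat -> Omega -> Obs) (alpha : R).
Hypothesis th01 : 0 < th < 1.
Hypotheses (mp : measurable_fun setT p) (mq : measurable_fun setT q).
Hypotheses (p0 : forall x, 0 <= p x) (q0 : forall x, 0 <= q x).
Hypotheses (p1 : (\int[nu]_x (p x)%:E = 1)%E) (q1 : (\int[nu]_x (q x)%:E = 1)%E).
Hypothesis mtau : forall k m, measurable [set w | tau k w = m].
Hypothesis mX : forall k t, measurable_fun setT (X k t).
Hypothesis law : forall (n : nat) (m : 'I_K -> option nat) (B : 'I_K -> nat -> set Obs),
  (forall k s, measurable (B k s)) ->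
  P [set w | (forall k, tau k w = m k) /\
             (forall k s, (0 < s <= n)%N -> B k s (X k s w))]
  = ((\prod_(k < K) (geom_pmf th (m k))%:E) *
     \prod_(k < K) \prod_(1 <= s < n.+1)
       \int[nu]_(x in B k s) (obs_dens p q (m k) s x)%:E)%E.
Hypothesis alpha0 : 0 <= alpha.

Local Notation Phi := (phi P nu th p q X alpha).

Lemma phi_T_alpha S s n : in_T_alpha P tau X alpha S ->
  (Phi S s.+1 n <= Phi S 1 (n + s))%E.
Proof.
move=> Sa; have [procS _] := Sa; elim: s n => [|s IH] n; first by rewrite addn0.
rewrite addnS -addSn; apply: le_trans (IH n.+1).
apply: (le_phi_step th01 mp mq p0 q0 p1 q1 mtau mX law procS n (ltn0Sn s)).
exact: (T_alpha_admissible th01 mp mq p0 q0 p1 q1 mtau mX law procS Sa (ltn0Sn s)).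
Qed.

Lemma phi_T_star S s n : is_Tstar P tau X alpha S -> Phi S s.+1 n = Phi S 1 (n + s).
Proof.
move=> Sstar; have [procS _] := Sstar; elim: s n => [|s IH] n; first by rewrite addn0.
rewrite addnS -addSn -IH.
apply: (phi_step_greedy th01 mp mq p0 q0 p1 q1 mtau mX law procS n (ltn0Sn s)).
exact: (T_star_greedy th01 mp mq p0 q0 p1 q1 mtau mX law procS alpha0 Sstar (ltn0Sn s)).
Qed.

(** The comparison holds term by term: the expected number of active streams is maximal at each time
    separately. *)
Lemma util_le_T_star S S' t : is_Tstar P tau X alpha S -> in_T_alpha P tau X alpha S' ->
  (\int[P]_w (util R S' t w)%:E <= \int[P]_w (util R S t w)%:E)%E.
Proof.
move=> Sstar S'a; have [procS _] := Sstar; have [procS' _] := S'a.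
rewrite (integral_util P nu th p q alpha mX procS) (integral_util P nu th p q alpha mX procS').
rewrite !big_add1 /=; apply: lee_sum => s _.
rewrite (phi_T_star _ _ Sstar) (phi_first P nu th p q alpha _ procS procS').
exact: phi_T_alpha.
Qed.

Lemma T_star_optimal S t : is_Tstar P tau X alpha S ->
  in_T_alpha P tau X alpha S /\
  (\int[P]_w (util R S t w)%:E =
   ereal_sup [set e | exists S' : nat -> Omega -> {set 'I_K},
                in_T_alpha P tau X alpha S' /\ e = \int[P]_w (util R S' t w)%:E])%E.
Proof.
move=> Sstar; have [procS _] := Sstar.
have Sa := T_star_in_T_alpha th01 mp mq p0 q0 p1 q1 mtau mX law procS alpha0 Sstar.
split => //; apply/eqP; rewrite eq_le; apply/andP; split.
  by apply: ereal_sup_ubound; exists S.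
by apply: ge_ereal_sup => _ [S' [S'a ->]]; exact: util_le_T_star.
Qed.

End Optimality.

(* The base measure need not be sigma-finite, but it can be replaced by the finite
   measure of density [p + q]. *)
Lemma finite_base_measure d (T : measurableType d) (R : realType)
    (mu : {measure set T -> \bar R}) (p q : T -> R) :
  measurable_fun setT p -> measurable_fun setT q ->
  (forall x, 0 <= p x) -> (forall x, 0 <= q x) ->
  (\int[mu]_x (p x)%:E = 1)%E -> (\int[mu]_x (q x)%:E = 1)%E ->
  exists (nu : {sigma_finite_measure set T -> \bar R}) (p' q' : T -> R),
    [/\ measurable_fun setT p' /\ measurable_fun setT q',
        forall x, 0 <= p' x, forall x, 0 <= q' x,
        forall B, measurable B -> (\int[mu]_(x in B) (p x)%:E = \int[nu]_(x in B) (p' x)%:E)%E &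
        forall B, measurable B -> (\int[mu]_(x in B) (q x)%:E = \int[nu]_(x in B) (q' x)%:E)%E].
Proof.
move=> mp mq p0 q0 p1 q1; pose g x := p x + q x.
have mg : measurable_fun setT g by exact: measurable_funD.
have g0 x : 0 <= g x by rewrite addr_ge0.
pose nu0 := densitym mu mg g0.
have nu0fin : fin_num_fun nu0.
  move=> A mA; rewrite ge0_fin_numE ?measure_ge0//.
  apply: (@le_lt_trans _ _ (nu0 setT)); first by apply: le_measure; rewrite ?inE.
  rewrite /nu0 densitymE /g; under eq_integral do rewrite EFinD.
  rewrite ge0_integralD//; last 4 first.
  - by move=> x _; rewrite lee_fin.
  - exact/measurable_EFinP.
  - by move=> x _; rewrite lee_fin.
  - exact/measurable_EFinP.
  by rewrite p1 q1 ltry.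
have H (f : T -> R) : measurable_fun setT f -> (forall x, 0 <= f x) ->
    (forall x, f x <= g x) -> forall B, measurable B ->
    (\int[mu]_(x in B) (f x)%:E = \int[nu0]_(x in B) (f x / g x)%:E)%E.
  move=> mf f0 fg B mB.
  have f'0 x : 0 <= f x / g x by rewrite divr_ge0.
  rewrite integral_mkcond [RHS]integral_mkcond.
  rewrite (@ge0_integral_density _ _ _ mu nu0 g _ mg g0)//.
  (* Where [g] vanishes, so does [f], being squeezed between 0 and [g]; the quotient by zero is
     therefore harmless. *)
  - apply: eq_integral => x _; rewrite !patchE; case: ifP => _; last by rewrite mul0e.
    rewrite -EFinM; have [gx|gx] := eqVneq (g x) 0; last by rewrite divfK.
    by rewrite gx mulr0; congr EFin; apply/eqP; rewrite eq_le f0 -gx fg.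
  - apply/(measurable_restrictT _ mB).1; apply: measurable_funTS.
    by apply/measurable_EFinP/measurable_funM => //; exact: measurable_funVr.
  - by move=> x; rewrite patchE; case: ifP => // _; rewrite lee_fin.
exists (finm nu0fin), (fun x => p x / g x), (fun x => q x / g x); split.
- by split; apply: measurable_funM => //; exact: measurable_funVr.
- by move=> x; rewrite divr_ge0.
- by move=> x; rewrite divr_ge0.
- by apply: H => // x; rewrite /g lerDl.
- by apply: H => // x; rewrite /g lerDr.
Qed.

Theorem theorem1 (R : realType) (d dO : measure_display)
  (Omega : measurableType d) (Obs : measurableType dO)
  (P : probability Omega R) (mu : {measure set Obs -> \bar R})
  (K : nat) (theta : R) (p q : Obs -> R)
  (tau : 'I_K -> Omega -> option nat) (X : 'I_K -> nat -> Omega -> Obs)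
  (alpha : R) :
  (1 <= K)%N ->
  model_Ms P mu theta p q tau X ->
  0 < alpha <= 1 ->
  (exists S, is_Tstar P tau X alpha S) /\
  forall S, is_Tstar P tau X alpha S ->
    in_T_alpha P tau X alpha S /\
    forall t, (1 <= t)%N ->
      (\int[P]_w (util R S t w)%:E =
       ereal_sup [set e | exists S' : nat -> Omega -> {set 'I_K},
                    in_T_alpha P tau X alpha S' /\
                    e = \int[P]_w (util R S' t w)%:E])%E.
Proof.
move=> _ [th01 [mp p0 p1] [mq q0 q1] [mtau mX] law] /andP[/ltW alpha0 _].
have [nu [p' [q' [[mp' mq'] p'0 q'0 pE qE]]]] := finite_base_measure mp mq p0 q0 p1 q1.
have p'1 : (\int[nu]_x (p' x)%:E = 1)%E by rewrite -pE.
have q'1 : (\int[nu]_x (q' x)%:E = 1)%E by rewrite -qE.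
(* The joint law involves [p] and [q] only through their integrals over sets, which [nu] with the
   new densities reproduces. *)
have law' (n : nat) (m : 'I_K -> option nat) (B : 'I_K -> nat -> set Obs) :
  (forall k s, measurable (B k s)) ->
  P [set w | (forall k, tau k w = m k) /\
             (forall k s, (0 < s <= n)%N -> B k s (X k s w))]
  = ((\prod_(k < K) (geom_pmf theta (m k))%:E) *
     \prod_(k < K) \prod_(1 <= s < n.+1)
       \int[nu]_(x in B k s) (obs_dens p' q' (m k) s x)%:E)%E.
  move=> mB; rewrite law//; congr (_ * _)%E; apply: eq_bigr => k _.
  by apply: eq_bigr => s _; rewrite /obs_dens; case: cp_lt; rewrite ?pE ?qE.
have optimal := T_star_optimal th01 mp' mq' p'0 q'0 p'1 q'1 mtau mX law' alpha0.
split; first by exists (Tstar P tau X alpha); exact: is_Tstar_Tstar.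
by move=> S Sstar; split => [|t _]; [have [] := optimal S 0%N Sstar|have [] := optimal S t Sstar].
Qed.
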